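(* Let $\theta\in[\tfrac12,1]$ and $k>0$. Given $W^{n}\in V_{h}$, there exists a solution of the fully discrete $\theta$-scheme at the next time level, i.e. there exists $W^{n+1}\in V_{h}$ such that, with $W^{n+\theta}=\theta W^{n+1}+(1-\theta)W^{n}$, for all $\chi\in V_{h}$ $$\Big(\frac{W^{n+1}-W^{n}}{k},\chi\Big)+\nu(\nabla W^{n+\theta},\nabla\chi)+w_{d}(\nabla W^{n+\theta}\cdot\mathbf{1},\chi)+(W^{n+\theta}(\nabla W^{n+\theta}\cdot\mathbf{1}),\chi)+\int_{\partial\Omega}\Big(2(c_{2}+w_{d})W^{n+\theta}+\frac{2}{9c_{2}}(W^{n+\theta})^{3}\Big)\chi\,d\Gamma=0.$$
   Context: $\Omega\subset\mathbb{R}^{2}$ is a bounded domain with smooth boundary $\partial\Omega$. Constants: $\nu>0$, $c_{2}>0$, $w_{d}\ge0$; $\mathbf{1}=(1,1)$; $(\cdot,\cdot)$ is the $L^{2}(\Omega)$ inner product; $k$ is the time step size. $T_{h}$ is a regular triangulation (finitely many triangles with pairwise disjoint interiors, boundary vertices on $\partial\Omega$), and $V_{h}=\{\phi_{h}\in C^{0}(\bar\Omega):\phi_{h}|_{K}\in P_{1}(K)\ \forall K\in T_{h}\}$, regarded as a finite-dimensional subspace of $H^{1}(\Omega)$.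
   Formalization: Straight triangles cannot cover a smooth domain, so V_h as written is not a finite-dimensional subspace of H^1; here each K is its triangle cut to the closure of Omega, possibly enlarged by adjacent boundary skin, so that these elements cover the closure of Omega, and P_1(K) is meant on them. *)

(* Defs.v *)
From HB Require Import structures.
From mathcomp Require Import all_boot all_order all_algebra.
From mathcomp Require Import all_classical all_reals all_analysis.

Set Implicit Arguments.
Unset Strict Implicit.
Unset Printing Implicit Defensive.

Import Order.TTheory GRing.Theory Num.Theory.
Import numFieldNormedType.Exports.

Local Open Scope classical_set_scope.
Local Open Scope ring_scope.

Section Defs.
Context {R : realType}.

Notation plane := (R * R)%type.

Definition smooth (f : R -> R) : Prop :=
  forall (n : nat) (t : R), derivable (derive1n n f) t 1.

(* The velocity is taken componentwise. *)
Definition speed (g : R -> plane) (t : R) : R :=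
  Num.sqrt (derive1 (fst \o g) t ^+ 2 + derive1 (snd \o g) t ^+ 2).

Record smooth_closed_curve (g : R -> plane) : Prop := SmoothClosedCurve {
  curve_smooth1 : smooth (fst \o g) ;
  curve_smooth2 : smooth (snd \o g) ;
  curve_regular : forall t, speed g t != 0 ;
  curve_period : forall t, g (t + 1) = g t ;
  curve_simple : forall s t, s \in `[0, 1[ -> t \in `[0, 1[ -> g s = g t -> s = t
}.

(* A bounded planar domain whose boundary is a finite disjoint union of smooth
   regular Jordan curves; several curves are allowed, so the domain may have
   holes.  Since the domain is connected, the Jordan curve theorem puts it on
   one side of each curve, so no further condition is needed for the boundary
   to be smooth.  For an open set, closure minus the set is its boundary. *)
Record smooth_domain := SmoothDomain {
  dom :> set plane ;
  dom_open : open dom ;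
  dom_nonempty : dom !=set0 ;
  dom_connected : connected dom ;
  dom_bounded : bounded_set dom ;
  ncurves : nat ;
  bcurve : 'I_ncurves -> R -> plane ;
  bcurve_smooth : forall i, smooth_closed_curve (bcurve i) ;
  bcurve_disjoint : forall i j s t, bcurve i s = bcurve j t -> i = j ;
  bcurve_boundary : closure dom `\` dom = \bigcup_i range (bcurve i)
}.

(* \int_Omega f dx, for the planar Lebesgue measure *)
Definition int_dom (Om : smooth_domain) (f : plane -> R) : R :=
  \int[(lebesgue_measure \x lebesgue_measure)%E]_(x in (Om : set plane)) f x.

(* \int_{\partial Omega} f dGamma, for the arc length *)
Definition int_bd (Om : smooth_domain) (f : plane -> R) : R :=
  \sum_(i < ncurves Om)
    \int[lebesgue_measure]_(t in `[0, 1]) (f (bcurve i t) * speed (bcurve i) t).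

Definition ip (Om : smooth_domain) (f g : plane -> R) : R :=
  int_dom Om (fun x => f x * g x).

(* Classical partial derivatives. A finite element function has them at every
   point of Omega off finitely many lines, where they agree with its weak
   derivatives; the arbitrary values elsewhere do not affect the integrals. *)
Definition pd1 (f : plane -> R) (x : plane) : R := derive1 (fun t => f (t, x.2)) x.1.
Definition pd2 (f : plane -> R) (x : plane) : R := derive1 (fun t => f (x.1, t)) x.2.

Definition ip_grad (Om : smooth_domain) (f g : plane -> R) : R :=
  int_dom Om (fun x => pd1 f x * pd1 g x + pd2 f x * pd2 g x).

(* \nabla f . (1, 1) *)
Definition grad_dot1 (f : plane -> R) (x : plane) : R := pd1 f x + pd2 f x.

Definition triangle (v : 'I_3 -> plane) : set plane :=
  [set x | exists a : 'I_3 -> R,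
    [/\ forall j, 0 <= a j, \sum_j a j = 1 & x = \sum_j a j *: v j]].

Definition nondegenerate (v : 'I_3 -> plane) : Prop :=
  let e1 := v 1 - v 0 in let e2 := v 2%:R - v 0 in
  e1.1 * e2.2 - e1.2 * e2.1 != 0.

(* A smooth domain is never exactly the union of finitely many straight
   triangles, so each triangle comes with the element it determines on the
   closure of Omega: the part of the triangle in the closure of Omega, plus
   possibly some of the skin between the polygon and the boundary of Omega.
   As elements are closed, the skin of an element meets the polygon, in the
   limit, only along its own triangle.  This covers both curved boundary
   triangles and the affine extension of functions from the polygon to Omega,
   and makes the finite element space a finite-dimensional subspace of
   H^1(Omega). *)
Record triangulation (Om : smooth_domain) := Triangulation {
  ntri : nat ;
  vertex : 'I_ntri -> 'I_3 -> plane ;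
  elt : 'I_ntri -> set plane ;
  polygon := \bigcup_i triangle (vertex i) ;
  tri_nondegenerate : forall i, nondegenerate (vertex i) ;
  tri_disjoint : forall i j, i != j ->
    (triangle (vertex i))° `&` (triangle (vertex j))° = set0 ;
  tri_bd_vertex : forall i j, (closure polygon `\` polygon°) (vertex i j) ->
    (closure Om `\` Om) (vertex i j) ;
  elt_closed : forall i, closed (elt i) ;
  elt_cover : \bigcup_i elt i = closure Om ;
  elt_disjoint : forall i j, i != j -> (elt i)° `&` (elt j)° = set0 ;
  elt_tri : forall i, triangle (vertex i) `&` closure Om `<=` elt i ;
  elt_skin : forall i, elt i `\` triangle (vertex i) `<=` ~` polygon
}.

Definition P1_on (K : set plane) (f : plane -> R) : Prop :=
  exists a b c : R, forall x, K x -> f x = a + b * x.1 + c * x.2.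

(* Only the values on the closure of Omega matter. *)
Definition Vh (Om : smooth_domain) (Th : triangulation Om) : set (plane -> R) :=
  [set f : plane -> R | {within closure Om, continuous f} /\ forall i, P1_on (@elt Om Th i) f].

End Defs.

Arguments smooth_domain R : clear implicits.

(* Main.v *)
(** Testing the scheme with [W = W^(n+theta)] itself, the terms that are not
    obviously nonnegative are the integrals over [Om] of [W grad W . 1] and
    [W^2 grad W . 1].  They are controlled by the boundary terms through the
    trace inequality [|int_Om d_l H| <= 2 int_bd |H|] for [H = W^2] and
    [H = W^3]: with this constant the energy is bounded below by the boundary
    integral of [2 / (9 c2) W^2 (3 c2 - |W|)^2], so it is nonnegative.  A zero
    of the Galerkin residual, written in an [L^2]-orthonormal basis of [Vh],
    then exists by the Brouwer theorem for coercive fields.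

    The trace inequality uses neither normals nor the Jordan curve theorem.
    Extend [H] by zero outside the closure of [Om]; then the integral over the
    plane of [H(x + h e_l) - H(x)] vanishes.  Points [x] for which the segment
    from [x] to [x + h e_l] meets the boundary lie in small rectangles around
    the pieces of a fine partition of the boundary curves, of total area at
    most about [h] times the length.  Dividing by [h] and letting [h] tend to
    [0] gives the inequality; the factor [2] comes from the two ends of the
    segment.

    Brouwer's theorem is obtained in the form of Poincare and Miranda from a
    cubical cup product modulo 2: the cup product of the coboundaries of the
    sign cochains of the components sums to [1] over a grid on the cube, so
    some small cube sees a sign change of every component. *)

Require Import Defs.
From HB Require Import structures.
From mathcomp Require Import all_boot all_order all_algebra.
From mathcomp Require Import all_classical all_reals all_analysis.
From mathcomp Require Import measurable_realfun ring lra.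
Set Implicit Arguments.
Unset Strict Implicit.
Unset Printing Implicit Defensive.
Import Order.TTheory GRing.Theory Num.Theory.
Import numFieldNormedType.Exports.
Local Open Scope classical_set_scope.
Local Open Scope ring_scope.

(** * The Poincare-Miranda theorem *)

(** The unknown is [W = W^(n+theta)]. Since [W^(n+1) - W^n = (W - W^n) / theta], the scheme is a
    system for [W] alone, and [(W - W^n, W) >= 0] as soon as the [L^2] norm of [W] is at least that
    of [W^n]. The constants balance as follows. The two transport terms are [1/2] and [1/3] of
    integrals of [d_1 H + d_2 H] for [H = W^2] and [H = W^3], so the trace inequality costs at most
    [2 wd W^2 + 4/3 |W|^3] on the boundary. The first part is the [wd] share of the boundary term,
    and what remains, [2 c2 W^2 - 4/3 |W|^3 + 2/(9 c2) W^4], is the nonnegative expression of the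
    overview. Integrals are taken instead over an open subset of [Om] of full measure on which all
    basis functions are locally affine, and Lipschitz bounds along segments in [Om] control the
    difference quotients. *)

Section CubicalCup.
Variables (I : eqType) (m : nat).
Implicit Types (x y : I -> nat) (s K : seq I) (g : (I -> nat) -> 'F_2).

Definition upd x i (t : nat) : I -> nat := fun k => if k == i then t else x k.
Definition step x i : I -> nat := fun k => (x k + (k == i))%N.

(** Vertex cochains with values modulo 2, so that no orientation signs appear. *)
Variable a : I -> (I -> nat) -> 'F_2.

(* The cup product of the coboundaries of the cochains [a i], [i] in [s], on
   the unit cube with lowest corner [x] and directions [K]. *)
Fixpoint cup s K x : 'F_2 :=
  if s is i :: s' then
    \sum_(j <- K) (a i (step x j) - a i x) * cup s' [seq k <- K | k != j] (step x j)
  else 1.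

Lemma F2_addrr (u : 'F_2) : u + u = 0.
Proof. by apply: addrr_pchar2; rewrite pchar_Fp. Qed.

(** The terms at [(i, j)] and [(j, i)] cancel modulo 2. *)
Lemma sum_symm_offdiag (K : seq I) (F : I -> I -> 'F_2) :
  (forall i j, F i j = F j i) -> \sum_(i <- K) \sum_(j <- K | j != i) F i j = 0.
Proof.
move=> Fs; elim: K => [|k K IH]; first by rewrite big_nil.
rewrite big_cons big_cons eqxx /=.
rewrite [X in _ + X](eq_bigr (fun i => (if k != i then F k i else 0) +
    \sum_(j <- K | j != i) F i j)); last first.
  by move=> i _; rewrite big_cons; case: ifP => _; rewrite ?add0r// Fs.
rewrite big_split/= IH addr0 -big_mkcond/=.
rewrite [X in _ + X](eq_bigl (fun i => i != k)) ?F2_addrr// => i.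
by rewrite eq_sym.
Qed.

Lemma filter_neqC K i j :
  [seq k <- [seq k <- K | k != i] | k != j] = [seq k <- [seq k <- K | k != j] | k != i].
Proof. by rewrite -!filter_predI; apply: eq_filter => k /=; rewrite andbC. Qed.

Lemma stepC x i j : step (step x i) j = step (step x j) i.
Proof. by apply: funext => k; rewrite /step addnAC. Qed.

(** A cup product of coboundaries is a cocycle: upper and lower faces of a cube contribute
    equally. *)
Lemma cup_closed s K x :
  \sum_(j <- K) cup s [seq k <- K | k != j] (step x j) =
  \sum_(j <- K) cup s [seq k <- K | k != j] x.
Proof.
elim: s K x => [//|i s IH] K x /=.
pose d j k := cup s [seq l <- [seq l <- K | l != j] | l != k].
have dC j k : d j k = d k j by rewrite /d filter_neqC.
have IHj j y : \sum_(k <- K | k != j) d j k (step y k) =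
               \sum_(k <- K | k != j) d j k y.
  by have := IH [seq l <- K | l != j] y; rewrite !big_filter.
under eq_bigr do rewrite big_filter.
under [RHS]eq_bigr do rewrite big_filter.
apply/eqP; rewrite -subr_eq0 -sumrB; apply/eqP.
(* By the induction hypothesis the expression regroups into double sums that are symmetric in [j]
   and [k], hence zero modulo 2. *)
have -> : \sum_(j <- K)
   (\sum_(k <- K | k != j) (a i (step (step x j) k) - a i (step x j)) * d j k (step (step x j) k)
     - \sum_(k <- K | k != j) (a i (step x k) - a i x) * d j k (step x k)) =
  \sum_(j <- K) \sum_(k <- K | k != j) a i (step (step x j) k) * d j k (step (step x j) k)
  - \sum_(j <- K) \sum_(k <- K | k != j) (a i (step x j) * d j k (step x j) + a i (step x k) * d j k (step x k))
  + a i x * \sum_(j <- K) \sum_(k <- K | k != j) d j k x.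
  rewrite mulr_sumr -sumrB -big_split/=; apply: eq_bigr => j _.
  rewrite big_split/= -!mulr_sumr -(IHj j x) -(IHj j (step x j)) !mulr_sumr opprD addrA.
  rewrite -!sumrB -big_split/=; apply: eq_bigr => k _; ring.
rewrite [X in a i x * X]sum_symm_offdiag ?mulr0 ?addr0; last first.
  by move=> j k; rewrite dC.
rewrite [X in X - _]sum_symm_offdiag; last first.
  by move=> j k; rewrite stepC dC.
rewrite sum_symm_offdiag ?subr0// => j k.
by rewrite addrC dC (dC k j).
Qed.

Definition delta j g x := g (step x j) - g x.

(** Leibniz rule: as the remaining product is closed, the whole product is the coboundary of [a i]
    times it. *)
Lemma cup_exact i s K x : cup (i :: s) K x =
  \sum_(j <- K) delta j (fun y => a i y * cup s [seq k <- K | k != j] y) x.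
Proof.
rewrite /delta sumrB -mulr_sumr -cup_closed mulr_sumr -sumrB /=.
by apply: eq_bigr => j _; rewrite mulrBl.
Qed.

Fixpoint gridsum s g x : 'F_2 :=
  if s is i :: s' then \sum_(t < m) gridsum s' g (upd x i t) else g x.

Lemma gridsum_sum s (K : seq I) (g : I -> (I -> nat) -> 'F_2) x :
  gridsum s (fun y => \sum_(j <- K) g j y) x = \sum_(j <- K) gridsum s (g j) x.
Proof.
elim: s x => //= i s IH x.
by rewrite exchange_big/=; apply: eq_bigr => t _; rewrite IH.
Qed.

Lemma eq_gridsum s g g' x :
  (forall y, (forall k, k \notin s -> y k = x k) -> g y = g' y) ->
  gridsum s g x = gridsum s g' x.
Proof.
elim: s x => [|i s IH] x gg' /=; first by apply: gg'.
apply: eq_bigr => t _; apply: IH => y yx; apply: gg' => k.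
by rewrite inE negb_or => /andP[ki ks]; rewrite yx// /upd (negbTE ki).
Qed.

Lemma gridsumB s g g' x :
  gridsum s (fun y => g y - g' y) x = gridsum s g x - gridsum s g' x.
Proof. by elim: s x => //= i s IH x; rewrite -sumrB; apply: eq_bigr. Qed.

Lemma gridsum_step s j g x : j \notin s ->
  gridsum s (fun y => g (step y j)) x = gridsum s g (step x j).
Proof.
elim: s x => //= i s IH x; rewrite inE negb_or => /andP[ji js].
apply: eq_bigr => t _; rewrite IH//; congr gridsum.
apply: funext => k; rewrite /step /upd; case: (eqVneq k i) => // ->.
by rewrite eq_sym (negbTE ji) addn0.
Qed.

(** The sum telescopes in direction [j]; this is the discrete Stokes formula. *)
Lemma gridsum_delta_head j s g x : j \notin s ->
  gridsum (j :: s) (delta j g) x = gridsum s g (upd x j m) - gridsum s g (upd x j 0%N).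
Proof.
move=> js /=.
rewrite (eq_bigr (fun t : 'I_m => gridsum s g (upd x j t.+1) - gridsum s g (upd x j t))).
  rewrite -(big_mkord xpredT (fun t => gridsum s g (upd x j t.+1) - gridsum s g (upd x j t))).
  by rewrite telescope_sumr.
move=> t _; rewrite /delta gridsumB gridsum_step//; congr (gridsum _ _ _ - _).
by apply: funext => k; rewrite /step /upd; case: eqP; rewrite ?addn1 ?addn0.
Qed.

Lemma gridsum_delta_eq0 j s g x : j \in s -> uniq s ->
  (forall y, y j = 0%N \/ y j = m -> g y = 0) -> gridsum s (delta j g) x = 0.
Proof.
move=> js us g0; elim: s x js us => //= i s IH x.
rewrite inE => /orP[/eqP <-|js] /andP[iNs us]; last first.
  by rewrite big1// => t _; rewrite IH.
rewrite -/(gridsum (j :: s) (delta j g) x) gridsum_delta_head//.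
have z t : t = 0%N \/ t = m -> gridsum s g (upd x j t) = 0.
  move=> t0m; rewrite (eq_gridsum (g' := fun=> 0 - 0)) ?gridsumB ?subrr// => y yx.
  by rewrite g0 ?subr0// yx// /upd eqxx.
by rewrite !z ?subr0; [|left|right].
Qed.

Hypothesis a0 : forall i x, x i = 0%N -> a i x = 0.
Hypothesis a1 : forall i x, x i = m -> a i x = 1.

(** The steps in [K] stay on the face, where [a j] is constant, so the factor coming from [a j]
    vanishes. *)
Lemma cup_face j s K x : j \in s -> j \notin K -> x j = 0%N \/ x j = m -> cup s K x = 0.
Proof.
have step_face k y : j != k -> (step y k) j = y j.
  by move=> jk; rewrite /step (negbTE jk) addn0.
elim: s K x => // i s IH K x; rewrite inE => js jK xj /=.
rewrite big_seq big1// => k kK.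
have jk : j != k by apply: contraNneq jK => ->.
have [ij|ij] := eqVneq j i.
  rewrite -ij; case: xj => xj.
    by rewrite !a0 ?step_face// subrr mul0r.
  by rewrite !a1 ?step_face// subrr mul0r.
rewrite IH ?mulr0//; last by rewrite step_face.
  by move: js; rewrite (negbTE ij).
by rewrite mem_filter (negbTE jK) andbF.
Qed.

(** Induction on [s] with the Stokes formula: the faces transverse to the other directions
    contribute zero by [cup_face], the face [x i = 0] by [a0], and on the face [x i = m] the factor
    [a i] is one and the sum for the shorter list remains. *)
Lemma gridsum_cup s x : uniq s -> gridsum s (cup s s) x = 1.
Proof.
elim: s x => // i s IH x us; have /andP[iNs us'] := us.
rewrite (_ : cup (i :: s) (i :: s) = fun y => \sum_(j <- i :: s)
    delta j (fun z => a i z * cup s [seq k <- i :: s | k != j] z) y); last first.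
  by apply: funext => y; exact: cup_exact.
rewrite gridsum_sum big_cons big_seq big1 ?addr0; last first.
  move=> j js; apply: gridsum_delta_eq0 => //.
    by rewrite inE js orbT.
  move=> y yj; rewrite (cup_face (j := j)) ?mulr0//.
  by rewrite mem_filter eqxx.
have -> : [seq k <- i :: s | k != i] = s.
  rewrite /= eqxx /=; apply/all_filterP/allP => k ks.
  by apply: contraNneq iNs => <-.
rewrite gridsum_delta_head// (eq_gridsum (g' := cup s s)); last first.
  by move=> y yx; rewrite a1 ?mul1r// yx// /upd eqxx.
rewrite IH// (eq_gridsum (g' := fun=> 0 - 0)) ?gridsumB ?subrr ?subr0// => y yx.
by rewrite a0 ?mul0r ?subr0// yx// /upd eqxx.
Qed.

Lemma gridsum_neq0 s g x : gridsum s g x != 0 ->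
  exists2 y, (forall k, k \in s -> (y k < m)%N) /\ (forall k, k \notin s -> y k = x k) & g y != 0.
Proof.
elim: s x => [|i s IH] x /= gx; first by exists x.
have [[t /IH[y [ylt yx] gy]]|all0] :=
    pselect (exists t : 'I_m, gridsum s g (upd x i t) != 0).
  exists y => //; split=> k; rewrite inE => //; last first.
    by rewrite negb_or => /andP[ki ks]; rewrite yx// /upd (negbTE ki).
  case: (boolP (k \in s)) => [ks _|ks]; first exact: ylt.
  by rewrite orbF => /eqP ki; rewrite yx// /upd ki eqxx.
case/eqP: gx; rewrite big1// => t _; apply/eqP/negPn/negP => tn0.
by apply: all0; exists t.
Qed.

(** A nonzero product has a nonzero term, that is, a monotone edge path in the cube whose successive
    edges each see a change of one [a i]. *)
Lemma cup_neq0 s K x i : uniq K -> cup s K x != 0 -> i \in s ->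
  exists y y', [/\ forall k, (x k <= y k <= x k + (k \in K))%N,
    forall k, (x k <= y' k <= x k + (k \in K))%N & a i y != a i y'].
Proof.
elim: s K x => // i' s IH K x uK /= cx; rewrite inE => is_.
have [j jK tj] : exists2 j, j \in K &
    (a i' (step x j) - a i' x) * cup s [seq k <- K | k != j] (step x j) != 0.
  apply: contrapT => nex; case/eqP: cx; rewrite big_seq big1// => j jK.
  by apply/eqP/negPn/negP => tn0; apply: nex; exists j.
move: tj; rewrite mulf_eq0 negb_or => /andP[aj cj].
have [ii'|ii'] := eqVneq i i'.
  exists (step x j), x; split=> [k|k|].
  - rewrite /step leq_addr leq_add2l; case: eqP => //= ->; by rewrite jK.
  - by rewrite leqnn leq_addr.
  - by rewrite -subr_eq0 ii'.
have {is_} si : i \in s by move: is_; rewrite (negbTE ii').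
have [//|y [y' [yx y'x ayy']]] := IH _ _ _ cj si; first exact: filter_uniq.
have E k (z : I -> nat) :
    (step x j k <= z k <= step x j k + (k \in [seq k <- K | k != j]))%N ->
    (x k <= z k <= x k + (k \in K))%N.
  rewrite /step mem_filter; case: (eqVneq k j) => [->|kj] /=.
    by rewrite jK addn0 => /andP[h ->]; rewrite (leq_trans _ h)// leq_addr.
  by rewrite addn0.
by exists y, y'; split=> // k; apply: E.
Qed.

End CubicalCup.

(** Heine-Cantor for a function continuous relative to [K], from the near-covering form of
    compactness. *)
Lemma compact_unif_cont (R : realType) (V W : normedModType R) (K : set V) (f : V -> W) :
  compact K -> {within K, continuous f} -> forall e, 0 < e ->
  exists2 d, 0 < d & forall x y, K x -> K y -> `|x - y| < d -> `|f x - f y| < e.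
Proof.
move=> /compact_near_coveringP cK /subspace_continuousP cf e e0.
pose P (d : R) (x : V) := K x -> forall y, K y -> `|x - y| < d -> `|f x - f y| < e.
have : \forall d \near (0 : R)^'+, K `<=` P d.
  apply: cK => x Kx.
  have := cf x Kx (ball (f x) (e / 2)) (nbhsx_ballx _ _ (divr_gt0 e0 (ltr0Sn _ 1))).
  move=> /nbhs_ballP[r /= r0 xr]; have r20 : 0 < r / 2 by rewrite divr_gt0.
  have fr z : K z -> `|x - z| < r -> `|f x - f z| < e / 2.
    by move=> Kz xz; have := xr z; rewrite -!ball_normE/=; apply.
  exists (ball x (r / 2), [set d | d < r / 2]); first split=> /=.
  - exact: nbhsx_ballx.
  - exact: nbhs_right_lt.
  - case=> x' d /= [xx' dr] Kx' y Ky x'y.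
    move: xx'; rewrite -ball_normE/= => xx'.
    have -> : f x' - f y = - (f x - f x') + (f x - f y).
      by rewrite opprB addrA subrK.
    rewrite (le_lt_trans (ler_normD _ _))// normrN (splitr e) ltrD//.
      by apply: fr => //; rewrite (lt_trans xx')// ltr_pdivrMr// ltr_pMr// ltr1n.
    apply: fr => //; rewrite -[x](subrK x') -addrA (le_lt_trans (ler_normD _ _))//.
    by rewrite (splitr r) ltrD// (lt_trans x'y).
move=> /(filterI (nbhs_right_gt (0 : R))) /filter_ex[d [d0 Pd]].
by exists d => // x y Kx Ky; apply: Pd.
Qed.

Lemma continuous_sum (R : realType) (T : topologicalType) (V : normedModType R)
    (I : Type) (s : seq I) (F : I -> T -> V) :
  (forall i, continuous (F i)) -> continuous (fun x => \sum_(i <- s) F i x).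
Proof.
move=> cF; elim: s => [|i s IH] x.
  by under eq_fun do rewrite big_nil; exact: cvg_cst.
by under eq_fun do rewrite big_cons; apply: cvgD; [exact: cF|exact: IH].
Qed.

(** * Zeros of continuous vector fields *)

Section Brouwer.
Variable R : realType.

Lemma rV_norm_lt n (x : 'rV[R]_n) (e : R) : 0 < e -> (`|x| < e) <-> (forall i, `|x 0 i| < e).
Proof.
move=> e0; rewrite [`|x|]mx_normrE; split=> [/bigmax_ltP[_ h] i|h].
  by have := h (0, i) isT.
by apply/bigmax_ltP; split=> // -[i j] _ /=; rewrite ord1.
Qed.

Lemma compact_cube n (r : R) : compact [set x : 'rV[R]_n | forall i, `|x 0 i| <= r].
Proof.
have := @rV_compact _ n (fun=> `[- r, r]%classic) (fun=> @segment_compact _ _ _).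
congr compact; apply/seteqP; split=> x /= h i; have := h i;
  by rewrite /= in_itv/= ler_norml.
Qed.

Theorem poincare_miranda n (f : 'rV[R]_n -> 'rV[R]_n) (r : R) : 0 < r -> continuous f ->
  (forall (x : 'rV[R]_n) i, x 0 i = r -> 0 <= f x 0 i) ->
  (forall (x : 'rV[R]_n) i, x 0 i = - r -> f x 0 i <= 0) ->
  exists x : 'rV[R]_n, (forall i, `|x 0 i| <= r) /\ f x = 0.
Proof.
move=> r0 cf fr fNr.
pose Q := [set x : 'rV[R]_n | forall i, `|x 0 i| <= r].
have cQ : compact Q by exact: compact_cube.
have Q0 : Q !=set0 by exists 0 => i /=; rewrite mxE normr0 ltW.
have cfQ : {within Q, continuous f} by exact: continuous_subspaceT.
have : {within Q, continuous (fun x => `|f x|)}.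
  by apply: continuous_subspaceT => x; apply: continuous_comp; [exact: cf|exact: norm_continuous].
(* If the minimum [|f c|] is positive, a grid on whose cells [f] varies by less than [|f c|] will
   contain a point with a smaller value. *)
move=> /(EVT_min_rV Q0 cQ)[c]; rewrite inE => Qc cmin.
have [fc0|fc0] := eqVneq (f c) 0; first by exists c.
have e0 : 0 < `|f c| by rewrite normr_gt0.
have [d d0 ud] := compact_unif_cont cQ cfQ e0.
pose m := (Num.truncn (2 * r / d)).+1.
have m0 : 0 < m%:R :> R by rewrite ltr0n.
have md : 2 * r / m%:R < d.
  by rewrite ltr_pdivrMr// [d * _]mulrC -ltr_pdivrMr// truncnS_gt.
pose pt (x : 'I_n -> nat) : 'rV[R]_n := \row_i (- r + 2 * r * (x i)%:R / m%:R).
have ptQ x : (forall i, (x i <= m)%N) -> Q (pt x).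
  move=> xm i; rewrite mxE ler_norml.
  have q0 : 0 <= 2 * r * (x i)%:R / m%:R by rewrite divr_ge0 ?mulr_ge0 ?ler0n ?(ltW r0).
  have q1 : 2 * r * (x i)%:R / m%:R <= 2 * r.
    by rewrite ler_pdivrMr// ler_wpM2l ?mulr_ge0 ?ler0n ?(ltW r0)// ler_nat.
  by apply/andP; split; lra.
(* The sign of the component [i], with the values on the two extreme faces imposed: there [f] may
   vanish, but [a0] and [a1] must hold. *)
pose a (i : 'I_n) x : 'F_2 := if x i == 0%N then 0 else
  if x i == m then 1 else if 0 < f (pt x) 0 i then 1 else 0.
have a0 i x : x i = 0%N -> a i x = 0 by rewrite /a => ->.
have a1 i x : x i = m -> a i x = 1 by rewrite /a => ->; rewrite eqxx.
have asgn i x y : a i x != a i y ->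
    exists2 b : bool, 0 <= f (pt (if b then x else y)) 0 i
                    & f (pt (if b then y else x)) 0 i <= 0.
  have A1 z : a i z = 1 -> 0 <= f (pt z) 0 i.
    rewrite /a; case: eqP => // _; case: eqP => [zm _|_].
      by apply: fr; rewrite mxE zm mulfK ?gt_eqF//; ring.
    by case: ltP => // /ltW.
  have A0 z : a i z = 0 -> f (pt z) 0 i <= 0.
    rewrite /a; case: eqP => [z0 _|_].
      by apply: fNr; rewrite mxE z0 mulr0 mul0r addr0.
    by case: eqP => // _; case: ltP.
  have A01 z : a i z = 0 \/ a i z = 1.
    by rewrite /a; do 3 (case: ifP => _; [by auto|]); left.
  case: (A01 x) => ax; case: (A01 y) => ay; rewrite ax ay ?eqxx// => _.
    by exists false; [exact: A1|exact: A0].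
  by exists true; [exact: A1|exact: A0].
have /gridsum_neq0[x [xm _] cx] :
    gridsum m (enum 'I_n) (cup a (enum 'I_n) (enum 'I_n)) (fun=> 0%N) != 0.
  by rewrite (gridsum_cup a0 a1) ?enum_uniq.
have xltm i : (x i < m)%N by apply: xm; rewrite mem_enum.
suff : `|f (pt x)| < `|f c|.
  rewrite ltNge cmin// inE; apply: ptQ => i; exact: ltnW.
apply/(rV_norm_lt _ e0) => i.
have [y [z [xy xz /asgn[b fy fz]]]] := cup_neq0 (enum_uniq _) cx (mem_enum _ i).
(* The component [i] has opposite weak signs at [y] and [z], and at the corner [x] it differs from
   both values by less than [|f c|], so it is itself smaller than [|f c|] in absolute value. *)
have close (w : 'I_n -> nat) : (forall k, (x k <= w k <= x k + (k \in enum 'I_n))%N) ->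
    `|f (pt x) 0 i - f (pt w) 0 i| < `|f c|.
  move=> xw; suff /(rV_norm_lt _ e0)/(_ i) : `|f (pt x) - f (pt w)| < `|f c| by rewrite !mxE.
  apply: ud.
  - by apply: ptQ => k; exact: ltnW.
  - apply: ptQ => k; have /andP[_ /leq_trans] := xw k; apply.
    by rewrite mem_enum addn1.
  - apply/(rV_norm_lt _ d0) => k; rewrite !mxE; apply: le_lt_trans md.
    have -> : - r + 2 * r * (x k)%:R / m%:R - (- r + 2 * r * (w k)%:R / m%:R)
      = - (2 * r / m%:R * ((w k)%:R - (x k)%:R)) by ring.
    have /andP[xwk] := xw k; rewrite mem_enum addn1 => wxk.
    rewrite normrN normrM ger0_norm; last by rewrite divr_ge0 ?mulr_ge0 ?ltW.
    rewrite ler_piMr ?divr_ge0 ?mulr_ge0 ?(ltW r0)// -natrB// normr_nat.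
    by rewrite -[leRHS]/(1%:R) ler_nat leq_subLR addn1.
have := close _ xy; have := close _ xz; move: fy fz; case: b => fy fz;
  rewrite !ltr_norml => /andP[p1 p2] /andP[p3 p4]; apply/andP; split; lra.
Qed.

Definition sqn n (x : 'rV[R]_n) : R := \sum_i x 0 i ^+ 2.

Lemma continuous_sqn n : continuous (@sqn n).
Proof.
apply: continuous_sum => i x.
under eq_fun do rewrite expr2.
have h := @coord_continuous R 1 n 0 i x.
exact: (continuousM h h).
Qed.

(** The map sending [x] to the radial projection of [x - P x] on the Euclidean ball of radius [r]
    has a fixed point, and coercivity excludes that the projection moved [x - P x]. *)
Theorem coercive_zero n (P : 'rV[R]_n -> 'rV[R]_n) (r : R) : 0 < r -> continuous P ->
  (forall x, sqn x = r ^+ 2 -> 0 <= \sum_i P x 0 i * x 0 i) ->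
  exists x, P x = 0.
Proof.
move=> r0 cP Pr.
pose N (y : 'rV[R]_n) := Num.sqrt (sqn y).
pose s y := r / Num.max r (N y).
(* The projected point has all coordinates in [[-r, r]], which gives the sign conditions on the
   faces of the cube. *)
pose f (x : 'rV[R]_n) : 'rV[R]_n := x - s (x - P x) *: (x - P x).
have M0 y : 0 < Num.max r (N y) by rewrite lt_max r0.
have s0 y : 0 < s y by rewrite divr_gt0.
have cN : continuous N.
  by move=> y; exact: (continuous_comp (@continuous_sqn n y) (@sqrt_continuous R _)).
have cs : continuous s.
  move=> y; apply: (@continuousM _ _ (cst r) (fun y => (Num.max r (N y))^-1)).
    exact: cst_continuous.
  apply: (@continuousV _ _ (fun y => Num.max r (N y))); first by rewrite gt_eqF.
  by apply: (@continuous_max _ _ (cst r) N y); [exact: cst_continuous|exact: cN].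
have cg : continuous (fun x : 'rV[R]_n => x - P x).
  by move=> x; apply: (@continuousB _ _ _ id P); [exact: cvg_id|exact: cP].
have cf : continuous f.
  move=> x; apply: (@continuousB _ _ _ id (fun x : 'rV[R]_n => s (x - P x) *: (x - P x))).
    exact: cvg_id.
  exact: (continuousZ (continuous_comp (cg x) (cs _)) (cg x)).
have sqn_ge0 (y : 'rV[R]_n) : 0 <= sqn y by apply: sumr_ge0 => i _; rewrite sqr_ge0.
have leN (y : 'rV[R]_n) i : `|y 0 i| <= N y.
  rewrite -sqrtr_sqr ler_wsqrtr// /sqn (bigD1 i)//= lerDl.
  by apply: sumr_ge0 => j _; rewrite sqr_ge0.
have sle y i : `|(s y *: y) 0 i| <= r.
  rewrite mxE normrM gtr0_norm// /s mulrAC ler_pdivrMr// ler_wpM2l ?(ltW r0)//.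
  by rewrite le_max leN orbT.
have [x [_ fx]] : exists x : 'rV[R]_n, (forall i, `|x 0 i| <= r) /\ f x = 0.
  apply: poincare_miranda => // x i xi; have := sle (x - P x) i;
    rewrite /f !mxE xi ler_norml => /andP[h1 h2]; lra.
exists x.
move: fx => /eqP; rewrite subr_eq0 => /eqP xE.
have [le|gt] := leP (N (x - P x)) r.
  move: xE; rewrite /s (max_idPl le) divff ?gt_eqF// scale1r.
  by move=> /eqP; rewrite eq_sym addrC -subr_eq0 addrK oppr_eq0 => /eqP.
have sE : s (x - P x) = r / N (x - P x) by rewrite /s; congr (_ / _); exact/max_idPr/ltW.
have N0 : 0 < N (x - P x) by exact: lt_trans gt.
set t := s (x - P x) in xE sE.
have t0 : 0 < t by rewrite sE divr_gt0.
have t1 : t < 1 by rewrite sE ltr_pdivrMr// mul1r.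
(* Here [x - P x] lies outside the ball, so [x] is on the sphere and [P x] is a negative multiple of
   [x], against the hypothesis [Pr]. *)
have PE : P x = (1 - t^-1) *: x.
  rewrite scalerBl scale1r {3}xE scalerA mulVf ?gt_eqF// scale1r.
  by rewrite opprB addrCA subrr addr0.
have sx : sqn x = r ^+ 2.
  have -> : sqn x = t ^+ 2 * sqn (x - P x).
    rewrite {1}xE /sqn mulr_sumr; apply: eq_bigr => i _; by rewrite mxE exprMn.
  by rewrite sE -[sqn _](sqr_sqrtr (sqn_ge0 (x - P x))) -/(N _) -exprMn divfK ?gt_eqF.
have := Pr x sx; rewrite PE.
under eq_bigr do rewrite mxE -mulrA -expr2.
rewrite -mulr_sumr -/(sqn x) sx pmulr_lge0 ?exprn_gt0// subr_ge0.
by rewrite invf_le1// leNgt t1.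
Qed.

End Brouwer.

(** * Integration *)

Section NullSets.
Context d (T : measurableType d) (R : realType) (mu : {measure set T -> \bar R}).

Import HBNNSimple.

(** The integrand may fail to be measurable, as classical partial derivatives can outside the
    regular set. The integral is a supremum over simple functions, and cutting these off on [N]
    preserves their integrals. *)
Lemma ge0_integral_setD_null (D N : set T) (f : T -> \bar R) :
  measurable N -> mu N = 0%E -> (forall x, 0 <= f x)%E ->
  (\int[mu]_(x in D) f x = \int[mu]_(x in D `\` N) f x)%E.
Proof.
move=> mN N0 f0; apply/eqP; rewrite eq_le; apply/andP; split; last first.
  rewrite (integral_mkcond D) (integral_mkcond (D `\` N)).
  rewrite !ge0_integralTE; try by move=> x; exact: erestrict_ge0.
  apply: ereal_sup_le => _ [h /= hf <-]; exists h => // x; apply: (le_trans (hf x)); rewrite !patchE in_setD.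
  by case: (x \in D); case: (x \in N).
rewrite ge0_integralE; last by move=> x _; exact: f0.
apply: ge_ereal_sup => _ [h /= hf <-].
rewrite -integralT_nnsfun (@ge0_negligible_integral _ _ _ _ _ N)//; last 2 first.
- by apply/measurable_EFinP; exact: measurable_funP.
- by move=> x _; rewrite lee_fin fun_ge0.
rewrite [leLHS]integral_mkcond [leRHS]ge0_integralE; last by move=> x _; exact: f0.
have -> : ((fun x => (h x)%:E) \_ ([set: T] `\` N) =
           EFin \o proj_nnsfun h (measurableC mN))%E.
  apply/funext => x; rewrite /= patchE /proj_nnsfun/= mindicE in_setD in_setC in_setT /=.
  by case: (x \in N) => /=; rewrite ?mulr1 ?mulr0.
rewrite integralT_nnsfun; apply: ereal_sup_ubound.
exists (proj_nnsfun h (measurableC mN)) => // x.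
have := hf x; rewrite !patchE /= mindicE in_setD in_setC.
case: (x \in N); case: (x \in D) => //=; rewrite ?mulr1 ?mulr0//.
Qed.

Lemma Rintegral_setD_null (D N : set T) (f : T -> R) :
  measurable N -> mu N = 0%E ->
  \int[mu]_(x in D) f x = \int[mu]_(x in D `\` N) f x.
Proof.
move=> mN N0; rewrite /Rintegral integralE [in RHS]integralE; congr (fine (_ - _)%E).
  by apply: ge0_integral_setD_null.
by apply: ge0_integral_setD_null.
Qed.

End NullSets.

Section BoundedMeasurable.
Context d (T : measurableType d) (R : realType) (mu : {measure set T -> \bar R}).
Variable D : set T.
Hypotheses (mD : measurable D) (fD : (mu D < +oo)%E).

(** Unlike integrability, this property is stable under products, and on a set of finite measure it
    implies integrability. *)
Definition bm (f : T -> R) :=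
  measurable_fun D f /\ exists M, forall x, D x -> `|f x| <= M.

Lemma bm_integrable f : bm f -> mu.-integrable D (EFin \o f).
Proof.
move=> [mf [M fM]]; apply: measurable_bounded_integrable => //.
exists M; split; first exact: num_real.
by move=> M' MM' x /= Dx; rewrite (le_trans (fM _ Dx))// ltW.
Qed.

Lemma bm_cst c : bm (fun=> c).
Proof. by split; [exact: measurable_cst|exists `|c|]. Qed.

Lemma bmD f g : bm f -> bm g -> bm (fun x => f x + g x).
Proof.
move=> [mf [M fM]] [mg [N gN]]; split; first exact: measurable_funD.
by exists (M + N) => x Dx; rewrite (le_trans (ler_normD _ _))// lerD// ?fM ?gN.
Qed.

Lemma bmM f g : bm f -> bm g -> bm (fun x => f x * g x).
Proof.
move=> [mf [M fM]] [mg [N gN]]; split; first exact: measurable_funM.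
by exists (M * N) => x Dx; rewrite normrM ler_pM// ?fM ?gN.
Qed.

Lemma bmX f n : bm f -> bm (fun x => f x ^+ n).
Proof.
move=> bf; elim: n => [|n IH]; first exact: bm_cst.
by under eq_fun do rewrite exprS; exact: bmM.
Qed.

Lemma bmZ c f : bm f -> bm (fun x => c * f x).
Proof. by move=> bf; apply: bmM => //; exact: bm_cst. Qed.

Lemma bm_sum (I : Type) (s : seq I) (F : I -> T -> R) :
  (forall i, bm (F i)) -> bm (fun x => \sum_(i <- s) F i x).
Proof.
move=> bF; elim: s => [|i s IH].
  by under eq_fun do rewrite big_nil; exact: bm_cst.
by under eq_fun do rewrite big_cons; exact: bmD.
Qed.

Lemma bm_norm f : bm f -> bm (fun x => `|f x|).
Proof.
move=> [mf [M fM]]; split; first exact: measurableT_comp.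
by exists M => x Dx; rewrite normr_id fM.
Qed.

Lemma eq_bm f g : (forall x, D x -> f x = g x) -> bm f -> bm g.
Proof.
move=> fg [mf [M fM]]; split; last by exists M => x Dx; rewrite -fg// fM.
by apply: eq_measurable_fun mf => x; rewrite inE => /fg.
Qed.

Lemma RintegralD_bm f g : bm f -> bm g ->
  \int[mu]_(x in D) (f x + g x) = \int[mu]_(x in D) f x + \int[mu]_(x in D) g x.
Proof. by move=> bf bg; rewrite RintegralD//; exact: bm_integrable. Qed.

Lemma RintegralZ_bm c f : bm f ->
  \int[mu]_(x in D) (c * f x) = c * \int[mu]_(x in D) f x.
Proof. by move=> bf; rewrite RintegralZl//; exact: bm_integrable. Qed.

Lemma Rintegral_sum_bm (I : Type) (s : seq I) (F : I -> T -> R) :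
  (forall i, bm (F i)) ->
  \int[mu]_(x in D) (\sum_(i <- s) F i x) = \sum_(i <- s) \int[mu]_(x in D) F i x.
Proof.
move=> bF; elim: s => [|i s IH].
  under eq_Rintegral do rewrite big_nil.
  by rewrite Rintegral_cst// mul0r big_nil.
under eq_Rintegral do rewrite big_cons.
by rewrite RintegralD_bm ?IH ?big_cons//; exact: bm_sum.
Qed.

Lemma le_Rintegral_bm f g : bm f -> bm g -> (forall x, D x -> f x <= g x) ->
  \int[mu]_(x in D) f x <= \int[mu]_(x in D) g x.
Proof. by move=> bf bg fg; apply: le_Rintegral => //; exact: bm_integrable. Qed.

Lemma Rintegral_dominated_cvg (f_ : nat -> T -> R) (f : T -> R) (M : R) :
  (forall n, measurable_fun D (f_ n)) ->
  (forall n x, D x -> `|f_ n x| <= M) ->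
  (forall x, D x -> f_ ^~ x @ \oo --> f x) ->
  \int[mu]_(x in D) f_ n x @[n --> \oo] --> \int[mu]_(x in D) f x.
Proof.
move=> mf fM ff.
have iM : mu.-integrable D (EFin \o cst M) by apply: bm_integrable; exact: bm_cst.
have fME n x : D x -> (`|(f_ n x)%:E| <= (EFin \o cst M) x)%E.
  by move=> Dx; rewrite /= lee_fin fM.
have mfE n : measurable_fun D (EFin \o f_ n) by exact/measurable_EFinP.
have ffE x : D x -> (fun n => (f_ n x)%:E) @ \oo --> (f x)%:E.
  by move=> Dx; apply: cvg_EFin; [exact: nearW|exact: ff].
have mlim : measurable_fun D (EFin \o f).
  by apply/measurable_EFinP; exact: measurable_fun_cvg mf ff.
have [idf _ +] := @dominated_convergence _ _ _ mu D mD (fun n => EFin \o f_ n)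
  (EFin \o f) (EFin \o cst M) mfE mlim (aeW _ ffE) iM (aeW _ (fun x n => @fME n x)).
rewrite /Rintegral -[X in _ --> X]fineK; first exact: fine_cvg.
exact: integrable_fin_num.
Qed.

End BoundedMeasurable.

Lemma Rintegral_preimage d (T : measurableType d) (R : realType)
    (mu : {measure set T -> \bar R}) (phi : T -> T) (D : set T) (f : T -> R) :
  measurable_fun setT phi -> (forall A, measurable A -> mu (phi @^-1` A) = mu A) ->
  measurable D -> measurable_fun D f ->
  \int[mu]_(x in phi @^-1` D) f (phi x) = \int[mu]_(x in D) f x.
Proof.
move=> mphi muE mD /measurable_EFinP mf; rewrite /Rintegral integralE [in RHS]integralE.
have E (g : T -> \bar R) : measurable_fun D g -> (forall x, 0 <= g x)%E ->
    (\int[mu]_(x in phi @^-1` D) g (phi x) = \int[mu]_(x in D) g x)%E.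
  move=> mg g0; pose m' : {measure set T -> \bar R} := pushforward mu phi.
  rewrite (@eq_measure_integral _ _ _ D (m' mphi) mu g); last first.
    by move=> A mA _; rewrite -muE.
  by rewrite (@ge0_integral_pushforward _ _ _ _ _ _ mphi mu D g)// => x _; exact: g0.
pose F : T -> \bar R := EFin \o f.
congr (fine (_ - _)%E).
  rewrite -/(F^\+)%E -(E (F^\+)%E)//; last exact: measurable_funepos.
  by have -> : ((fun x => (f (phi x))%:E)^\+ = F^\+ \o phi)%E by rewrite -funepos_comp.
rewrite -/(F^\-)%E -(E (F^\-)%E)//; last exact: measurable_funeneg.
by have -> : ((fun x => (f (phi x))%:E)^\- = F^\- \o phi)%E by rewrite -funeneg_comp.
Qed.

(** * Lebesgue measure on the plane *)

Section Plane.
Variable R : realType.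
Local Notation leb := (@lebesgue_measure R).
Local Notation leb2 := (leb \x leb)%E.
Local Notation mR := (measurableTypeR R).
Implicit Types A B : set (R * R).

(** The sigma-algebra is the product one, so an open set is exhibited as a countable union of boxes
    with rational corners; boxes not contained in it are replaced by the empty set. *)
Lemma open_measurable_plane A : open A -> measurable (A : set (mR * mR)).
Proof.
move=> oA.
pose box (p : (rat * rat) * (rat * rat)) : set (R * R) :=
  `]ratr p.1.1, ratr p.1.2[%classic `*` `]ratr p.2.1, ratr p.2.2[%classic.
have -> : A = \bigcup_p (if `[< box p `<=` A >] then box p else set0).
  apply/seteqP; split=> x; last first.
    by move=> [p _]; case: ifPn => // /asboolP pA; exact: pA.
  move=> Ax; have /nbhs_ballP[e /= e0 xe] := open_nbhs_nbhs (conj oA Ax).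
  have itv (u : R) : exists q : rat * rat, [/\ u - e < ratr q.1, ratr q.1 < u,
      u < ratr q.2 & ratr q.2 < u + e].
    have [q1] := @rat_in_itvoo R (u - e) u (ltac:(lra)).
    have [q2] := @rat_in_itvoo R u (u + e) (ltac:(lra)).
    rewrite !in_itv/= => /andP[? ?] /andP[? ?].
    by exists (q1, q2).
  have [q1 [a1 a2 a3 a4]] := itv x.1; have [q2 [b1 b2 b3 b4]] := itv x.2.
  exists (q1, q2) => //; have -> : `[< box (q1, q2) `<=` A >].
    apply/asboolP => y [/=]; rewrite !in_itv/= => /andP[c1 c2] /andP[d1 d2].
    by apply: xe; split; rewrite /ball/= ltr_norml; apply/andP; split; lra.
  by split=> /=; rewrite in_itv/=; apply/andP.
apply: countable_bigcupT_measurable => // p; case: ifP => // _.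
by apply: measurableX; exact: measurable_itv.
Qed.

Lemma closed_measurable_plane A : closed A -> measurable (A : set (mR * mR)).
Proof. by move/closed_openC/open_measurable_plane/measurableC; rewrite setCK. Qed.

Lemma continuous_measurable_plane A (f : R * R -> R) :
  measurable (A : set (mR * mR)) -> {within A, continuous f} ->
  measurable_fun (A : set (mR * mR)) (f : mR * mR -> R).
Proof.
move=> mA /continuousP cf; apply: (measurability _ (RGenOpens.measurableE R)).
move=> _ [_ [a [b ->] <-]].
have /cf/open_subspaceP[V oV VA] := @interval_open R (BRight a) (BLeft b) isT isT.
rewrite setIC in VA; rewrite [X in measurable X](_ : _ = A `&` V); last first.
  rewrite VA.
  by rewrite setIC.
by apply: measurableI => //; exact: open_measurable_plane.
Qed.

(** The shifted measure agrees with Lebesgue measure on half-open intervals, which characterises the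
    latter. *)
Lemma lebesgue_shift (h : R) (A : set R) : measurable (A : set mR) ->
  leb ((fun x => x + h) @^-1` A) = leb A.
Proof.
move=> mA.
have mh : measurable_fun setT ((fun x => x + h) : mR -> mR).
  by apply: measurable_funD; [exact: measurable_id|exact: measurable_cst].
pose m' : {measure set mR -> \bar R} := pushforward leb (fun x : mR => (x + h : mR)).
rewrite -[LHS]/(m' mh A); symmetry; apply: lebesgue_measure_unique => // _ [[a b] _ <-] /=.
rewrite /m' /pushforward /=.
have -> : (fun x => x + h) @^-1` `]a, b]%classic = `]a - h, b - h]%classic.
  by apply/seteqP; split=> x /=; rewrite !in_itv/= ltrBlDr lerBrDr.
rewrite !lebesgue_measure_itv/= !lte_fin ltrD2r; case: ifP => // _.
by rewrite !EFinN/= -!EFinB; congr EFin; ring.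
Qed.

Lemma measurable_shift_plane (u : R * R) :
  measurable_fun setT ((fun x => (x.1 + u.1, x.2 + u.2)) : mR * mR -> mR * mR).
Proof.
apply/measurable_fun_pairP; split.
  by apply: measurable_funD; [exact: measurable_fst|exact: measurable_cst].
by apply: measurable_funD; [exact: measurable_snd|exact: measurable_cst].
Qed.

Lemma measurable_swap_plane :
  measurable_fun setT ((fun x => (x.2, x.1)) : mR * mR -> mR * mR).
Proof.
by apply/measurable_fun_pairP; split; [exact: measurable_snd|exact: measurable_fst].
Qed.

Lemma leb2_shift (u : R * R) A : measurable (A : set (mR * mR)) ->
  leb2 ((fun x => (x.1 + u.1, x.2 + u.2)) @^-1` A) = leb2 A.
Proof.
move=> mA; have mu := measurable_shift_plane u.
pose m' : {measure set (mR * mR)%type -> \bar R} :=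
  pushforward leb2 ((fun x => (x.1 + u.1, x.2 + u.2)) : mR * mR -> mR * mR).
rewrite -[LHS]/(m' mu A); symmetry; apply: product_measure_unique => // X Y mX mY.
have ms (v : R) Z : measurable Z -> measurable ((fun x : mR => (x + v : mR)) @^-1` Z).
  move=> mZ; rewrite -[X in measurable X]setTI.
  suff : measurable_fun setT ((fun x => x + v) : mR -> mR) by exact.
  by apply: measurable_funD; [exact: measurable_id|exact: measurable_cst].
apply: etrans (product_measure1E leb leb (ms u.1 _ mX) (ms u.2 _ mY)) _.
by congr (_ * _)%E; exact: lebesgue_shift.
Qed.

Lemma leb2_swap A : measurable (A : set (mR * mR)) ->
  leb2 ((fun x => (x.2, x.1)) @^-1` A) = leb2 A.
Proof.
move=> mA; have mu := measurable_swap_plane.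
pose m' : {measure set (mR * mR)%type -> \bar R} :=
  pushforward leb2 ((fun x => (x.2, x.1)) : mR * mR -> mR * mR).
rewrite -[LHS]/(m' mu A); symmetry; apply: product_measure_unique => // X Y mX mY.
apply: etrans (etrans (product_measure1E leb leb mY mX) (muleC _ _)).
by congr (leb2 _); apply/seteqP; split=> -[x y] [].
Qed.

Lemma Rintegral_leb2_shift (u : R * R) (D : set (R * R)) (f : R * R -> R) :
  measurable (D : set (mR * mR)) -> measurable_fun (D : set (mR * mR)) (f : mR * mR -> R) ->
  \int[leb2]_(x in (fun x => (x.1 + u.1, x.2 + u.2)) @^-1` D) f (x.1 + u.1, x.2 + u.2) =
  \int[leb2]_(x in D) f x.
Proof.
move=> mD mf; apply: (@Rintegral_preimage _ (mR * mR)%type R leb2 (fun x => (x.1 + u.1, x.2 + u.2)) D f) => //; first exact: measurable_shift_plane.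
by move=> A mA; exact: leb2_shift.
Qed.

Lemma Rintegral_leb2_swap (D : set (R * R)) (f : R * R -> R) :
  measurable (D : set (mR * mR)) -> measurable_fun (D : set (mR * mR)) (f : mR * mR -> R) ->
  \int[leb2]_(x in (fun x => (x.2, x.1)) @^-1` D) f (x.2, x.1) =
  \int[leb2]_(x in D) f x.
Proof.
move=> mD mf; apply: (@Rintegral_preimage _ (mR * mR)%type R leb2 (fun x => (x.2, x.1)) D f) => //; first exact: measurable_swap_plane.
by move=> A mA; exact: leb2_swap.
Qed.

Lemma leb2_box (a b c e : R) : a <= b -> c <= e ->
  leb2 (`[a, b]%classic `*` `[c, e]%classic) = ((b - a) * (e - c))%:E.
Proof.
move=> ab ce; rewrite product_measure1E//= !lebesgue_measure_itv/= !lte_fin.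
rewrite -!EFinB; have [ab'|ab'] := ltP a b; have [ce'|ce'] := ltP c e => //=.
- by rewrite mule0 (_ : e = c) ?subrr ?mulr0//; apply/eqP; rewrite eq_le ce'.
- by rewrite mul0e (_ : a = b) ?subrr ?mul0r//; apply/eqP; rewrite eq_le ab.
- by rewrite mul0e (_ : a = b) ?subrr ?mul0r//; apply/eqP; rewrite eq_le ab.
Qed.

Lemma leb2_vline (a : R) : leb2 ([set a] `*` setT) = 0%E.
Proof. by rewrite product_measure1E//= lebesgue_measure_set1 mul0e. Qed.

Lemma continuous_affine_plane (a b c : R) :
  continuous (fun x : R * R => a + b * x.1 + c * x.2).
Proof.
move=> x.
have c1 : {for x, continuous (fun x : R * R => x.1)} by exact: cvg_fst.
have c2 : {for x, continuous (fun x : R * R => x.2)} by exact: cvg_snd.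
have k (r : R) : {for x, continuous (fun _ : R * R => r)} by exact: cst_continuous.
exact: (continuousD (continuousD (k a) (continuousM (k b) c1)) (continuousM (k c) c2)).
Qed.

Lemma closed_line (a b c : R) : closed [set x : R * R | a + b * x.1 + c * x.2 = 0].
Proof.
apply: (@closed_comp _ _ (fun x : R * R => a + b * x.1 + c * x.2) [set 0]).
  by move=> x _; exact: continuous_affine_plane.
by apply: accessible_closed_set1; exact/hausdorff_accessible/Rhausdorff.
Qed.

(** Three cases: one-point sections when [c] is nonzero, a vertical line when only [c] vanishes, and
    the empty set when [b] and [c] vanish. The last occurs when two affine pieces differ by a
    constant. *)
Lemma leb2_line (a b c : R) : (a, b, c) != (0, 0, 0) ->
  leb2 [set x | a + b * x.1 + c * x.2 = 0] = 0%E.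
Proof.
move=> abc0; pose L := [set x : R * R | a + b * x.1 + c * x.2 = 0].
have mL := closed_measurable_plane (@closed_line a b c).
rewrite -/L; have [c0|c0] := eqVneq c 0; last first.
  rewrite /product_measure1 integral0_eq// => x _ /=.
  have -> : xsection L x = [set - (a + b * x) / c].
    apply/seteqP; split=> y; rewrite /xsection/= inE /L/= => h.
      by have -> : y = - (a + b * x) / c; [apply: (mulIf c0); rewrite divfK//; lra|].
    by rewrite h [c * _]mulrC divfK// subrr.
  exact: lebesgue_measure_set1.
have [b0|b0] := eqVneq b 0; last first.
  apply: (@subset_measure0 _ (mR * mR)%type R leb2 L ([set - a / b] `*` setT)) => //.
  - by apply: measurableX.
  - move=> x; rewrite /L/= c0 mul0r addr0 => h; split=> //=.
    by have -> : x.1 = - a / b; [apply: (mulIf b0); rewrite divfK//; lra|].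
  - exact: leb2_vline.
rewrite (_ : L = set0) ?measure0//; apply/seteqP; split=> // x.
rewrite /L/= b0 c0 !mul0r !addr0 => a0.
by move: abc0; rewrite a0 b0 c0 eqxx.
Qed.

End Plane.

(** * A trace inequality *)

Lemma lipschitz_derivable (R : realType) (f : R -> R) (M a b : R) : a <= b ->
  (forall x, derivable f x 1) ->
  (forall x, a <= x <= b -> `|derive1 f x| <= M) -> `|f b - f a| <= M * (b - a).
Proof.
move=> ab df fM.
have [x _||c] := @MVT_segment R f (derive1 f) a b ab.
- by rewrite derive1E; apply: derivableP; exact: df.
- by apply: derivable_within_continuous => x _; exact: df.
rewrite in_itv/= => cab ->; rewrite normrM (ger0_norm (_ : 0 <= b - a)) ?subr_ge0//.
by rewrite ler_wpM2r ?subr_ge0// fM.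
Qed.

Lemma Rintegral_indic d (T : measurableType d) (R : realType)
    (mu : {measure set T -> \bar R}) (D A : set T) :
  measurable D -> measurable A ->
  \int[mu]_(x in D) \1_A x = fine (mu (A `&` D)).
Proof. by move=> mD mA; rewrite /Rintegral integral_indic. Qed.

Lemma bm_indic d (T : measurableType d) (R : realType) (D A : set T) :
  measurable A -> bm D (\1_A : T -> R).
Proof.
move=> mA; split; first exact: measurable_indic.
by exists 1 => x _; rewrite indicE; case: (_ \in _); rewrite ?normr1 ?normr0.
Qed.

Lemma unit_itv_fin (R : realType) : (@lebesgue_measure R `[0%R, 1%R]%classic < +oo)%E.
Proof. by rewrite lebesgue_measure_itv/= lte_fin ltr01 -EFinB ltry. Qed.

Lemma continuous_bm (R : realType) (f : R -> R) : continuous f ->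
  bm (T := measurableTypeR R) `[0, 1]%classic f.
Proof.
move=> cf; split.
  by apply: subspace_continuous_measurable_fun => //; exact: continuous_subspaceT.
have c01 : {within `[(0 : R), 1], continuous f} by exact: continuous_subspaceT.
have [c _ cmax] := EVT_max ler01 c01; have [e _ emin] := EVT_min ler01 c01.
exists (Num.max (f c) (- f e)) => t t01.
by rewrite ler_norml lerNl !le_max; rewrite cmax// lerN2 emin// orbT.
Qed.

Lemma riemann_sum_le (R : realType) (phi : R -> R) (N : nat) (c : 'I_N -> R) :
  (0 < N)%N -> bm (T := measurableTypeR R) `[0, 1]%classic phi ->
  (forall t, 0 <= t <= 1 -> 0 <= phi t) ->
  (forall (j : 'I_N) t, j%:R / N%:R <= t <= j.+1%:R / N%:R -> c j <= phi t) ->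
  \sum_j c j / N%:R <= \int[lebesgue_measure]_(t in `[0, 1]) phi t.
Proof.
move=> N0 bphi phi0 cphi.
have N0' : 0 < N%:R :> R by rewrite ltr0n.
(* Half-open pieces are disjoint but miss [t = 1]; there the sum is zero and [phi0] is used. *)
pose I j : set (measurableTypeR R) := `[j%:R / N%:R, j.+1%:R / N%:R[%classic.
have mI j : measurable (I j) by exact: measurable_itv.
have m01 : measurable (`[0, 1]%classic : set (measurableTypeR R)) by exact: measurable_itv.
have -> : \sum_j c j / N%:R =
    \int[lebesgue_measure]_(t in `[0, 1]) \sum_(j < N) c j * \1_(I j) t.
  rewrite (Rintegral_sum_bm m01 (unit_itv_fin R)); last first.
    by move=> j; apply: bmZ; exact: bm_indic.
  apply: eq_bigr => j _; rewrite (RintegralZ_bm m01 (unit_itv_fin R)); last exact: bm_indic.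
  rewrite Rintegral_indic// setIidl; last first.
    move=> t; rewrite /I/= !in_itv/= => /andP[t1 t2]; rewrite (le_trans _ t1) ?divr_ge0//=.
    by rewrite (le_trans (ltW t2))// ler_pdivrMr// mul1r ler_nat.
  suff E : (lebesgue_measure (I j) = (N%:R^-1 : R)%:E)%E by congr (_ * _); rewrite -[LHS]/(fine _%:E) -E.
  rewrite /I lebesgue_measure_itv/= lte_fin ltr_pM2r ?invr_gt0// ltr_nat ltnSn/=.
  by rewrite -EFinB -natr1; congr EFin; ring.
apply: (le_Rintegral_bm m01 (unit_itv_fin R)) => //.
  by apply: bm_sum => j; apply: bmZ; exact: bm_indic.
move=> t /=; rewrite in_itv/= => t01.
have [[j jt]|nj] := pselect (exists j : 'I_N, I j t); last first.
  rewrite big1 ?phi0// => j _; rewrite indicE memNset ?mulr0// => jt.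
  by apply: nj; exists j.
rewrite (bigD1 j)//= big1 ?addr0.
  rewrite indicE mem_set// mulr1 cphi//.
  by move: jt; rewrite /I/= in_itv/= => /andP[-> /ltW ->].
move=> i ij; rewrite indicE memNset ?mulr0// => it; case/eqP: ij; apply/val_inj/eqP.
move: it jt; rewrite /I/= !in_itv/= => /andP[i1 i2] /andP[j1 j2].
have := le_lt_trans i1 j2; have := le_lt_trans j1 i2.
rewrite !ltr_pM2r ?invr_gt0// !ltr_nat !ltnS => h1 h2.
by rewrite eqn_leq h2.
Qed.

(** The parameters with [p r] in [A] are open in [[0, h]], and also closed because they are those
    with [p r] in [K]; connectedness concludes. *)
Lemma segment_stays (R : realType) (T : topologicalType) (A K : set T) (p : R -> T) (h : R) :
  0 <= h -> continuous p -> open A -> closed K -> A `<=` K ->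
  (forall r, 0 <= r <= h -> K (p r) -> A (p r)) ->
  forall r0, 0 <= r0 <= h -> A (p r0) -> forall r, 0 <= r <= h -> A (p r).
Proof.
move=> h0 cp oA cK AK KA r0 r0h Ar0 r rh.
have r0i : `[0, h]%classic r0 by rewrite /= in_itv.
have ri : `[0, h]%classic r by rewrite /= in_itv.
suff E : `[0, h]%classic `&` (p @^-1` A) = `[0, h]%classic.
  by move: ri; rewrite -E => -[].
apply: (@segment_connected R 0 h).
- by exists r0.
- by exists (p @^-1` A) => //; apply: open_comp => // x _; exact: cp.
- exists (p @^-1` K); first by apply: preimage_closed => // x _; exact: cp.
  apply/seteqP; split=> x [xi xA]; split=> //; first exact: AK.
  by apply: KA => //; move: xi; rewrite /= in_itv.
Qed.

Lemma lipschitz_derivable_dist (R : realType) (f : R -> R) (M a b : R) :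
  (forall x, derivable f x 1) ->
  (forall x, Num.min a b <= x <= Num.max a b -> `|derive1 f x| <= M) ->
  `|f b - f a| <= M * `|b - a|.
Proof.
move=> df; have [ab|ba] := leP a b => fM.
  by rewrite (ger0_norm (_ : 0 <= b - a)) ?subr_ge0//; exact: lipschitz_derivable.
rewrite distrC (distrC b) (ger0_norm (_ : 0 <= a - b)) ?subr_ge0 ?(ltW ba)//.
by apply: lipschitz_derivable; rewrite ?(ltW ba).
Qed.

Lemma bm_patch d (T : measurableType d) (R : realType) (D P : set T) (f : T -> R) :
  measurable D -> measurable P -> bm D f -> bm D (f \_ P).
Proof.
move=> mD mP [mf [M fM]]; split.
  by apply/measurable_restrict => //; apply: measurable_funS mf => // x [].
exists M => x Dx; rewrite patchE; case: ifP => _; first exact: fM.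
by rewrite normr0 (le_trans _ (fM x Dx)).
Qed.

Lemma min_max_itv (R : realType) (lo hi a b u : R) : lo <= a <= hi -> lo <= b <= hi ->
  Num.min a b <= u <= Num.max a b -> lo <= u <= hi.
Proof.
move=> /andP[? ?] /andP[? ?]; rewrite ge_min le_max => /andP[u1 u2].
by case/orP: u1; case/orP: u2 => *; apply/andP; split; lra.
Qed.

Lemma min_max_dist (R : realType) (a b u : R) :
  Num.min a b <= u <= Num.max a b -> `|u - a| <= `|b - a|.
Proof.
have [ab|ab] := leP a b => /andP[u1 u2].
  by rewrite !ger0_norm; lra.
by rewrite !ler0_norm; lra.
Qed.

Lemma slab_dist (R : realType) (x c d h : R) : c - d - h <= x -> x <= c + d ->
  0 <= d -> 0 <= h -> 2 * d <= h -> `|x - c| <= 2 * h /\ `|x + h - c| <= 2 * h.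
Proof. by move=> *; split; rewrite ler_norml; apply/andP; split; lra. Qed.

Lemma slab_mem (R : realType) (x c d h r : R) : 0 <= r -> r <= h ->
  - d <= x + r - c -> x + r - c <= d -> c - d - h <= x <= c + d.
Proof. by move=> *; apply/andP; split; lra. Qed.

Lemma interval_dist (R : realType) (x c e h : R) : c - e <= x -> x <= c + e ->
  0 <= e -> 2 * e <= h -> `|x - c| <= 2 * h.
Proof. by move=> *; rewrite ler_norml; apply/andP; split; lra. Qed.

Lemma norm_le_dist (R : realType) (x y b h : R) : `|y| <= b -> `|x - y| <= h -> `|x| <= b + h.
Proof. by rewrite !ler_norml => /andP[? ?] /andP[? ?]; apply/andP; split; lra. Qed.

Section Trace.
Variable R : realType.
Local Notation leb := (@lebesgue_measure R).
Local Notation leb2 := (leb \x leb)%E.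
Local Notation mR := (measurableTypeR R).
(** [A], [K], [g] and [s] stand for the domain, its closure, its boundary curves and their speeds.
    The speeds enter only through bounds on each component, so the hypotheses are symmetric in the
    two coordinates. *)
Variables (A K : set (R * R)) (m : nat) (g : 'I_m -> R -> R * R) (s : 'I_m -> R -> R).
Variable H : R * R -> R.
Hypotheses (oA : open A) (cK : compact K) (AK : A `<=` K).
Hypothesis KA : forall x, K x -> ~ A x -> exists i t, 0 <= t <= 1 /\ x = g i t.
Hypothesis gK : forall i t, K (g i t) /\ ~ A (g i t).
Hypotheses (dg1 : forall i t, derivable (fst \o g i) t 1)
  (dg2 : forall i t, derivable (snd \o g i) t 1) (cs : forall i, continuous (s i))
  (gs1 : forall i t, `|derive1 (fst \o g i) t| <= s i t)
  (gs2 : forall i t, `|derive1 (snd \o g i) t| <= s i t).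
Hypothesis cH : {within K, continuous H}.

Let s0 i t : 0 <= s i t.
Proof. exact: le_trans (gs1 i t). Qed.

Let clK : closed K.
Proof. by apply: compact_closed cK; exact: norm_hausdorff. Qed.

Let mK : measurable (K : set (mR * mR)).
Proof. exact: closed_measurable_plane. Qed.

Let mA : measurable (A : set (mR * mR)).
Proof. exact: open_measurable_plane. Qed.

Lemma plane_compact_bounded : exists2 b, 0 <= b & forall x, K x -> `|x.1| <= b /\ `|x.2| <= b.
Proof.
have [M [_ KM]] := compact_bounded cK; exists (`|M| + 1) => // x Kx.
have : `|x| <= `|M| + 1 by apply: KM => //; rewrite ltr_pwDr// ler_norm.
by rewrite prod_normE ge_max => /andP.
Qed.

Lemma compact_fun_bounded : exists B, forall x, K x -> `|H x| <= B.
Proof.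
have /compact_bounded[M [_ KM]] := continuous_compact cH cK.
by exists (`|M| + 1) => x Kx; apply: KM; [rewrite ltr_pwDr// ler_norm|exists x].
Qed.

Lemma continuous_curve i : continuous (g i).
Proof.
move=> t.
have c1 : {for t, continuous (fst \o g i)} by apply: differentiable_continuous; exact/derivable1_diffP.
have c2 : {for t, continuous (snd \o g i)} by apply: differentiable_continuous; exact/derivable1_diffP.
rewrite /continuous_at (surjective_pairing (g i t)).
have -> : g i = fun t => ((fst \o g i) t, (snd \o g i) t).
  by apply/funext => u; rewrite /= -surjective_pairing.
exact: (cvg_pair c1 c2).
Qed.

Lemma continuous_on_curve i : continuous (fun t => H (g i t)).
Proof.
move=> t; have [Kt _] := gK i t.
move/subspace_continuousP : cH => /(_ _ Kt) cHt.
apply: cvg_trans cHt => P /= wP.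
suff : \forall u \near t, K (g i u) -> P (H (g i u)).
  by apply: filterS => u; apply; have [] := gK i u.
exact: (@continuous_curve i t _ wP).
Qed.

Lemma bm_extension (Z : set (R * R)) : measurable (Z : set (mR * mR)) ->
  bm (Z : set (mR * mR)) (H \_ K).
Proof.
move=> mZ; have [B HB] := compact_fun_bounded; split.
  apply: (@measurable_funS _ _ _ _ setT) => //.
  apply/(measurable_restrictT (H : mR * mR -> R) mK).
  exact: continuous_measurable_plane.
exists `|B| => x _; rewrite patchE; case: ifPn => [|_]; last by rewrite normr0.
by rewrite inE => /HB /le_trans; apply; exact: ler_norm.
Qed.

Lemma curve_speed_bounded : exists2 M, 0 <= M & forall i t, 0 <= t <= 1 -> s i t <= M.
Proof.
have /choice[M sM] : forall i, exists M, forall t, 0 <= t <= 1 -> s i t <= M.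
  move=> i; have [_ [M sM]] := continuous_bm (cs (i := i)); exists M => t t01.
  by rewrite (le_trans (ler_norm _))// sM//= in_itv.
exists (\sum_i `|M i|); first exact: sumr_ge0.
move=> i t /sM /le_trans; apply; rewrite (le_trans (ler_norm _))//.
by rewrite (bigD1 i)//= lerDl sumr_ge0.
Qed.

(** The first bound makes the boxes of [bad_set] narrow compared with [h]; the second allows the
    speed on a piece to be replaced by its value at the midpoint. *)
Lemma fine_partition (M eta h : R) : 0 < eta -> 0 < h ->
  exists2 N, (0 < N)%N & (M + 1) / N%:R <= eta * h /\
    forall i t u, 0 <= t <= 1 -> 0 <= u <= 1 -> `|t - u| <= N%:R^-1 -> `|s i t - s i u| <= eta.
Proof.
move=> eta0 h0.
pose P i (N : nat) := forall t u, 0 <= t <= 1 -> 0 <= u <= 1 ->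
  `|t - u| <= N%:R^-1 -> `|s i t - s i u| <= eta.
have PN i : \forall N \near \oo, P i N.
  have ci : {within `[0, 1], continuous (s i)} by exact: continuous_subspaceT.
  have [d d0 sd] := compact_unif_cont (@segment_compact R 0 1) ci eta0.
  near=> N => t u t01 u01 tu; apply/ltW/sd; rewrite /= ?in_itv//.
  apply: le_lt_trans tu _; rewrite -[d]invrK ltf_pV2 ?posrE ?invr_gt0// ?ltr0n.
    by near: N; exact: nbhs_infty_gtr.
  by near: N; exact: nbhs_infty_gt.
have : \forall N \near \oo, [/\ forall i, P i N, (0 < N)%N & (M + 1) / (eta * h) <= N%:R].
  near=> N; split.
  - by near: N; exact: filter_forall.
  - by near: N; exact: nbhs_infty_gt.
  - by near: N; exact: nbhs_infty_ger.
case/filter_ex => N [NP N0 Nl]; exists N => //; split; last by move=> i; exact: NP.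
by rewrite ler_pdivrMr ?ltr0n// mulrC -ler_pdivrMr ?mulr_gt0.
Unshelve. all: by end_near. Qed.

Lemma midpoint_cover (N : nat) (t : R) : (0 < N)%N -> 0 <= t <= 1 ->
  exists j : 'I_N, `|t - (j%:R + 2^-1) / N%:R| <= (2 * N%:R)^-1.
Proof.
move=> N0 /andP[t0 t1]; have N0' : 0 < N%:R :> R by rewrite ltr0n.
have [j [jt tj]] : exists j : 'I_N, j%:R <= t * N%:R /\ t * N%:R <= j.+1%:R.
  (* The truncation of [t * N] would be out of range at [t = 1], which is put into the last
     piece. *)
  have [tl|tl] := ltP t 1; last first.
    have e : t = 1 by apply/eqP; rewrite eq_le t1.
    have lt : (N.-1 < N)%N by rewrite ltn_predL.
    by exists (Ordinal lt) => /=; rewrite e mul1r prednK// !ler_nat leq_pred.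
  have tN0 : 0 <= t * N%:R by rewrite mulr_ge0// ltW.
  have /andP[h1 h2] := truncn_itv tN0.
  have lt : (Num.truncn (t * N%:R) < N)%N.
    by rewrite -(ltr_nat R) (le_lt_trans h1)// gtr_pMl.
  by exists (Ordinal lt); split=> //; exact: ltW.
exists j; rewrite -(ler_pM2r N0') invfM -mulrA mulVf ?gt_eqF// mulr1.
rewrite -[X in _ * X <= _](ger0_norm (ltW N0')) -normrM mulrBl divfK ?gt_eqF//.
by move: tj; rewrite -natr1 ler_norml => tj; apply/andP; split; lra.
Qed.

(** [B] contains every [x] whose horizontal segment of length [h] meets a boundary curve. The second
    clause says that [B] shrinks to the boundary with [h], the third that segments starting in [A]
    off [B] stay in [A], which makes the last integrand meaningful. *)
Lemma bad_set (eta h : R) : 0 < eta -> eta <= 1 -> 0 < h ->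
  (forall x y, K x -> K y -> `|x.1 - y.1| <= 2 * h -> `|x.2 - y.2| <= 2 * h ->
    `|H x - H y| <= eta) ->
  exists B : set (R * R), [/\ measurable (B : set (mR * mR)),
    forall x, B x -> exists y, [/\ K y, ~ A y, `|x.1 - y.1| <= 2 * h & `|x.2 - y.2| <= 2 * h],
    forall x, A x -> ~ B x -> forall r, 0 <= r <= h -> A (x.1 + r, x.2) &
    `|\int[leb2]_(x in A `\` B) (H (x.1 + h, x.2) - H x)| <=
      h * (2 * (1 + eta) *
        \sum_i \int[leb]_(t in `[0, 1]) ((`|H (g i t)| + 2 * eta) * (s i t + 2 * eta)))].
Proof.
move=> eta0 eta1 h0 Hunif.
have [M M0 sM] := curve_speed_bounded.
have [N N0 [NM Ns]] := fine_partition M eta0 h0.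
have N0' : 0 < N%:R :> R by rewrite ltr0n.
pose tj (j : 'I_N) : R := (j%:R + 2^-1) / N%:R.
have tj01 j : 0 <= tj j <= 1.
  rewrite divr_ge0 ?addr_ge0 ?invr_ge0//= ler_pdivrMr// mul1r.
  have : j.+1%:R <= N%:R :> R by rewrite ler_nat.
  by rewrite -natr1; lra.
(* A piece stays within [d] of its midpoint horizontally and within [e] vertically. The crude speed
   bound [M] suffices for [d], which is negligible against [h]; the height [e] enters the area at
   first order and needs the local speed. *)
pose d : R := M / (2 * N%:R).
pose e i j : R := (s i (tj j) + eta) / (2 * N%:R).
have N20 : 0 < 2 * N%:R :> R by rewrite mulr_gt0.
have dh : 2 * d <= eta * h.
  apply: le_trans NM; rewrite /d.
  have -> : 2 * (M / (2 * N%:R)) = M / N%:R by field; rewrite gt_eqF.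
  by rewrite ler_pM2r ?invr_gt0//; lra.
have etah : eta * h <= h by rewrite ler_piMl// ltW.
have d0 : 0 <= d by rewrite divr_ge0// ltW.
have e0 i j : 0 <= e i j by rewrite divr_ge0 ?(ltW N20)// addr_ge0// ltW.
have eh i j : 2 * e i j <= h.
  apply: le_trans etah; apply: le_trans NM.
  have -> : 2 * e i j = (s i (tj j) + eta) / N%:R by rewrite /e; field; rewrite gt_eqF.
  by rewrite ler_pM2r ?invr_gt0// lerD// sM.
(* The box is lengthened by [h] to the left, to catch the left ends of all segments that meet the
   piece. *)
pose box (p : 'I_m * 'I_N) : set (R * R) :=
  `[(g p.1 (tj p.2)).1 - d - h, (g p.1 (tj p.2)).1 + d]%classic `*`
  `[(g p.1 (tj p.2)).2 - e p.1 p.2, (g p.1 (tj p.2)).2 + e p.1 p.2]%classic.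
have mbox p : measurable (box p : set (mR * mR)).
  by apply: measurableX; exact: measurable_itv.
pose B : set (R * R) := \bigcup_p box p.
have mB : measurable (B : set (mR * mR)) by exact: countable_bigcupT_measurable.
have boxP p x : box p x -> [/\ `|x.1 - (g p.1 (tj p.2)).1| <= 2 * h,
    `|x.1 + h - (g p.1 (tj p.2)).1| <= 2 * h & `|x.2 - (g p.1 (tj p.2)).2| <= 2 * h].
  move=> [/=]; rewrite !in_itv/= => /andP[a1 a2] /andP[b1 b2].
  have e0' := e0 p.1 p.2; have eh' := eh p.1 p.2; have d2h := le_trans dh etah.
  have [x1 x2] := slab_dist a1 a2 d0 (ltW h0) d2h; split=> //.
  exact: interval_dist b1 b2 e0' eh'.
have curve_in_box i t r x : 0 <= t <= 1 -> 0 <= r <= h -> g i t = (x.1 + r, x.2) -> B x.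
  move=> t01 /andP[r0 rh] gx; have [j jt] := midpoint_cover N0 t01.
  have btw u : Num.min (tj j) t <= u <= Num.max (tj j) t -> 0 <= u <= 1.
    exact: min_max_itv.
  have btw' u : Num.min (tj j) t <= u <= Num.max (tj j) t -> `|u - tj j| <= N%:R^-1.
    move=> /min_max_dist /le_trans; apply; rewrite (le_trans jt)// lef_pV2 ?posrE//.
    by lra.
  have g1 : `|(g i t).1 - (g i (tj j)).1| <= d.
    apply: (@le_trans _ _ (M * `|t - tj j|)).
      apply: (@lipschitz_derivable_dist _ (fst \o g i)) => // u /btw u01.
      by rewrite (le_trans (gs1 _ _))// sM.
    by rewrite /d ler_wpM2l.
  have g2 : `|(g i t).2 - (g i (tj j)).2| <= e i j.
    apply: (@le_trans _ _ ((s i (tj j) + eta) * `|t - tj j|)).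
      apply: (@lipschitz_derivable_dist _ (snd \o g i)) => // u uu.
      rewrite (le_trans (gs2 _ _))//.
      have := Ns i _ _ (btw _ uu) (tj01 j) (btw' _ uu); rewrite ler_norml => /andP[_ st]; lra.
    by rewrite /e ler_wpM2l// addr_ge0// ltW.
  move: g1 g2; rewrite gx/= !ler_norml => /andP[a1 a2] /andP[b1 b2].
  exists (i, j) => //; rewrite /box/=; split=> /=; rewrite in_itv/=; first exact: slab_mem a1 a2.
  by apply/andP; split; lra.
have KAout x r : ~ B x -> 0 <= r <= h -> K (x.1 + r, x.2) -> A (x.1 + r, x.2).
  move=> nB rh Kr; apply: contrapT => nA; have [i [t [t01 gt]]] := KA Kr nA.
  by apply: nB; exact: (curve_in_box i t r).
(* A segment that avoids the boundary and meets [A] lies entirely in [A]. *)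
have stays x r0 : ~ B x -> 0 <= r0 <= h -> A (x.1 + r0, x.2) ->
    forall r, 0 <= r <= h -> A (x.1 + r, x.2).
  move=> nB; apply: (@segment_stays R _ A K (fun r => (x.1 + r, x.2))) => //.
  - exact: ltW.
  - move=> r.
    have c1 : {for r, continuous (fun r => x.1 + r)}.
      by apply: continuousD; [exact: cst_continuous|exact: cvg_id].
    exact: (cvg_pair c1 (@cst_continuous _ _ x.2 r)).
  - by move=> r rh; exact: KAout.
exists B; split=> //.
- move=> x [p _ /boxP[x1 _ x2]]; exists (g p.1 (tj p.2)).
  by have [Kg Ag] := gK p.1 (tj p.2); split.
- move=> x Ax nB; apply: (stays x 0) => //; first by rewrite lexx ltW.
  by rewrite addr0 -surjective_pairing.
have [b b0 Kb] := plane_compact_bounded.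
(* The square [Z] contains [K], its translate and all boxes, so integrals over [Z] replace integrals
   over the plane. *)
pose z := b + 2 * h.
pose Z : set (R * R) := `[- z, z]%classic `*` `[- z, z]%classic.
have mZ : measurable (Z : set (mR * mR)) by apply: measurableX; exact: measurable_itv.
have z0 : - z <= z by rewrite /z; lra.
have fZ : (leb2 Z < +oo)%E by rewrite leb2_box// ltry.
have inZ x y : K y -> `|x.1 - y.1| <= 2 * h -> `|x.2 - y.2| <= 2 * h -> Z x.
  move=> /Kb[y1 y2] x1 x2.
  by split; rewrite /= in_itv/= -ler_norml; [exact: norm_le_dist x1|exact: norm_le_dist x2].
pose sh (x : R * R) : R * R := (x.1 + h, x.2).
have KZ : K `<=` Z by move=> x Kx; apply: (inZ x x) => //; rewrite subrr normr0 ?mulr_ge0// ltW.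
have shKZ : sh @^-1` K `<=` Z.
  move=> x Kx; apply: (inZ x (sh x)) => //=; rewrite ?subrr ?normr0 ?mulr_ge0 ?(ltW h0)//.
  by rewrite opprD addrA subrr add0r normrN gtr0_norm//; lra.
have boxZ p : box p `<=` Z.
  by move=> x /boxP[x1 _ x2]; apply: (inZ x _ (gK p.1 (tj p.2)).1).
have mshK : measurable (sh @^-1` K : set (mR * mR)).
  apply: closed_measurable_plane; apply: preimage_closed => // x _.
  have c1 : {for x, continuous (fun x : R * R => x.1 + h)}.
    by apply: continuousD; [exact: cvg_fst|exact: cst_continuous].
  exact: (cvg_pair c1 cvg_snd).
have msh : measurable_fun setT (sh : mR * mR -> mR * mR).
  apply/measurable_fun_pairP; split; last exact: measurable_snd.
  by apply: measurable_funD; [exact: measurable_fst|exact: measurable_cst].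
pose Ht := H \_ K; pose Delta x := Ht (sh x) - Ht x.
have bHt : bm (Z : set (mR * mR)) Ht by exact: bm_extension.
have bHsh : bm (Z : set (mR * mR)) (Ht \o sh).
  have [mHt _] := @bm_extension setT measurableT.
  have [_ [C HC]] := @bm_extension setT measurableT.
  split; last by exists C => x _; exact: HC.
  by apply: (@measurable_funS _ _ _ _ setT) => //; exact: (measurableT_comp mHt msh).
have E1 : \int[leb2]_(x in Z) Ht x = \int[leb2]_(x in K) H x.
  by rewrite -[in RHS](setIidr KZ) [RHS]Rintegral_mkcondr.
have E2 : \int[leb2]_(x in Z) (Ht \o sh) x = \int[leb2]_(x in sh @^-1` K) H (sh x).
  rewrite -[in RHS](setIidr shKZ) [RHS]Rintegral_mkcondr; apply: eq_Rintegral => x _.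
  by rewrite /= /Ht !patchE.
have shE : (fun x : R * R => (x.1 + h, x.2 + 0)) = sh.
  by apply/funext => x; rewrite addr0.
have E3 : \int[leb2]_(x in sh @^-1` K) H (sh x) = \int[leb2]_(x in K) H x.
  rewrite -shE; apply: (Rintegral_leb2_shift (h, 0) mK).
  exact: continuous_measurable_plane.
(* Translation invariance: the zero extension and its shift have the same integral. *)
have int0 : \int[leb2]_(x in Z) Delta x = 0.
  have := RintegralB mZ (bm_integrable mZ fZ bHsh) (bm_integrable mZ fZ bHt).
  by rewrite E1 E2 E3 subrr.
have bDelta : bm (Z : set (mR * mR)) Delta.
  by apply: bmD => //; under eq_fun do rewrite -mulN1r; exact: bmZ.
have mAB : measurable (A `\` B : set (mR * mR)) by exact: measurableD.
have ABZ : A `\` B `<=` Z by move=> x [/AK /KZ].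
have split_int : \int[leb2]_(x in Z) Delta x =
    \int[leb2]_(x in A `\` B) (H (sh x) - H x) + \int[leb2]_(x in Z) (Delta \_ B) x.
  have -> : \int[leb2]_(x in A `\` B) (H (sh x) - H x) =
            \int[leb2]_(x in Z) (Delta \_ (A `\` B)) x.
    rewrite -[RHS]Rintegral_mkcondr setIidr//; apply: eq_Rintegral => x; rewrite inE => -[Ax nB].
    have Ah : A (sh x) by apply: (stays x 0); rewrite ?lexx ?ltW ?addr0 -?surjective_pairing.
    by rewrite /Delta /Ht !patchE !mem_set//; exact: AK.
  rewrite -(RintegralD_bm mZ fZ); try by apply: bm_patch.
  apply: eq_Rintegral => x _; rewrite !patchE in_setD.
  have [xB|xB] := boolP (x \in B); first by rewrite andbF add0r.
  rewrite andbT addr0; case: ifPn => // xA; rewrite notin_setE in xA; rewrite notin_setE in xB.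
  (* Off [A] and off [B], the whole segment avoids [K], so both values of the extension are zero. *)
  have n0 r : 0 <= r <= h -> ~ K (x.1 + r, x.2).
    move=> rh Kr; apply: xA; have := stays x r xB rh (KAout x r xB rh Kr) 0.
    by rewrite addr0 -surjective_pairing; apply; rewrite lexx ltW.
  have nK : ~ K x by have := n0 0; rewrite addr0 -surjective_pairing; apply; rewrite lexx ltW.
  have nKh : ~ K (sh x) by apply: n0; rewrite lexx ltW.
  by rewrite /Delta /Ht !patchE !memNset// subrr.
(* Each of the two values in [Delta] is at most [|H|] at the midpoint plus [eta]; this is the source
   of the factor 2. *)
pose c (p : 'I_m * 'I_N) := 2 * (`|H (g p.1 (tj p.2))| + eta).
have c0 p : 0 <= c p by rewrite mulr_ge0// addr_ge0// ltW.
have DeltaB x : `|(Delta \_ B) x| <= \sum_p c p * \1_(box p) x.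
  have rhs0 : 0 <= \sum_p c p * \1_(box p) x by apply: sumr_ge0 => p _; rewrite mulr_ge0.
  rewrite patchE; case: ifPn => [|_]; last by rewrite normr0.
  rewrite inE => -[p _ xp]; rewrite (bigD1 p)//= -[leLHS]addr0 lerD//; last first.
    by apply: sumr_ge0 => q _; rewrite mulr_ge0.
  rewrite indicE mem_set// mulr1; have [x1 x2 x3] := boxP _ _ xp.
  have Kg := (gK p.1 (tj p.2)).1.
  have near_g y : `|y.1 - (g p.1 (tj p.2)).1| <= 2 * h -> `|y.2 - (g p.1 (tj p.2)).2| <= 2 * h ->
      `|Ht y| <= `|H (g p.1 (tj p.2))| + eta.
    move=> y1 y2; rewrite /Ht patchE; case: ifPn => [|_].
      rewrite inE => Ky; rewrite -lerBlDl (le_trans (lerB_dist _ _))//.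
      exact: Hunif.
    by rewrite normr0 addr_ge0// ltW.
  rewrite /Delta /c (le_trans (ler_normB _ _))// mulr2n mulrDl !mul1r lerD//.
    by apply: near_g.
  exact: near_g.
have -> : \int[leb2]_(x in A `\` B) (H (x.1 + h, x.2) - H x) =
    - \int[leb2]_(x in Z) (Delta \_ B) x.
  by apply/eqP; rewrite -addr_eq0; apply/eqP; rewrite -split_int.
have bB : bm (Z : set (mR * mR)) (Delta \_ B) by exact: bm_patch.
rewrite normrN (le_trans (le_normr_Rintegral mZ (bm_integrable mZ fZ bB)))//.
apply: (@le_trans _ _ (\int[leb2]_(x in Z) \sum_p c p * \1_(box p) x)).
  apply: (le_Rintegral_bm mZ fZ) => //; first exact: bm_norm.
  by apply: bm_sum => p; apply: bmZ; exact: bm_indic.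
rewrite (Rintegral_sum_bm mZ fZ); last by move=> p; apply: bmZ; exact: bm_indic.
rewrite -(pair_bigA _ (fun i j => \int[leb2]_(x in Z) (c (i, j) * \1_(box (i, j)) x)))/=.
rewrite mulrA mulr_sumr; apply: ler_sum => i _.
have bHg : bm (T := mR) `[0, 1]%classic (fun t => `|H (g i t)|).
  by apply: bm_norm; apply: continuous_bm; exact: continuous_on_curve.
have bs : bm (T := mR) `[0, 1]%classic (s i) by exact: continuous_bm.
have Hg_close j t : 0 <= t <= 1 -> `|t - tj j| <= N%:R^-1 ->
    `|H (g i (tj j))| <= `|H (g i t)| + eta.
  move=> t01 tt; rewrite -lerBlDl (le_trans (lerB_dist _ _))//.
  have Mt (f : R -> R) : (forall u, derivable f u 1) -> (forall u, `|derive1 f u| <= s i u) ->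
      `|f (tj j) - f t| <= 2 * h.
    move=> df fs; apply: (@le_trans _ _ (M * `|tj j - t|)).
      apply: lipschitz_derivable_dist => // u uu; rewrite (le_trans (fs u))// sM//.
      exact: min_max_itv uu.
    apply: (@le_trans _ _ (M / N%:R)); first by rewrite ler_wpM2l// distrC.
    apply: (@le_trans _ _ (eta * h)); last by lra.
    by apply: le_trans NM; rewrite ler_pM2r ?invr_gt0//; lra.
  apply: Hunif; [exact: (gK _ _).1|exact: (gK _ _).1| |].
    exact: (Mt (fst \o g i)).
  exact: (Mt (snd \o g i)).
(* Passing from the midpoint to any point of the piece costs a second [eta] in each factor. *)
have phi_le (j : 'I_N) t : j%:R / N%:R <= t <= j.+1%:R / N%:R ->
    (`|H (g i (tj j))| + eta) * (s i (tj j) + eta) <=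
    (`|H (g i t)| + 2 * eta) * (s i t + 2 * eta).
  move=> /andP[t1 t2].
  have t01 : 0 <= t <= 1.
    rewrite (le_trans _ t1) ?divr_ge0//= (le_trans t2)// ler_pdivrMr// mul1r ler_nat.
    exact: ltn_ord.
  have tt : `|t - tj j| <= N%:R^-1.
    rewrite ler_norml /tj; move: t2; rewrite -natr1 mulrDl mul1r => t2.
    have n2 : 0 <= N%:R^-1 / 2 :> R by rewrite divr_ge0 ?invr_ge0.
    by rewrite mulrDl; apply/andP; split; lra.
  apply: ler_pM; rewrite ?addr_ge0 ?(ltW eta0)//.
    by have hg := Hg_close j t t01 tt; lra.
  by have := Ns i _ _ t01 (tj01 j) tt; rewrite ler_norml => /andP[h1 _]; lra.
have phi0 t : 0 <= t <= 1 -> 0 <= (`|H (g i t)| + 2 * eta) * (s i t + 2 * eta).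
  by move=> _; rewrite mulr_ge0 ?addr_ge0 ?mulr_ge0 ?(ltW eta0).
have RS := riemann_sum_le N0
  (bmM (bmD bHg (bm_cst _ (2 * eta))) (bmD bs (bm_cst _ (2 * eta)))) phi0 phi_le.
have h20 : 0 <= h * (2 * (1 + eta)) by rewrite !mulr_ge0 ?addr_ge0 ?(ltW h0) ?(ltW eta0).
apply: le_trans (ler_wpM2l h20 RS).
rewrite mulr_sumr; apply: ler_sum => j _.
rewrite (RintegralZ_bm mZ fZ); last exact: bm_indic.
rewrite (Rintegral_indic _ mZ (mbox _)) setIidl; last exact: boxZ.
(* The width [2 * d + h] is at most [(1 + eta) * h], and the height is the local speed plus [eta],
   divided by [N]. *)
suff -> : fine (leb2 (box (i, j))) = (2 * d + h) * (2 * e i j).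
  rewrite /c /=.
  have -> : 2 * e i j = (s i (tj j) + eta) / N%:R by rewrite /e; field; rewrite gt_eqF.
  set X := `|_| + eta; set Y := (_ + eta) / _.
  have XY0 : 0 <= X * Y by rewrite mulr_ge0 ?divr_ge0 ?addr_ge0 ?(ltW eta0).
  have -> : 2 * X * ((2 * d + h) * Y) = (2 * d + h) * 2 * (X * Y) by ring.
  rewrite -[X * _ / _]mulrA -/Y ler_wpM2r//; lra.
have eij := e0 i j; rewrite /box leb2_box/=; [|by lra|by lra].
by ring.
Qed.

(** [D] is the one-sided derivative of [H] on a subset of full measure. The Lipschitz bound is asked
    only along segments inside [A], since [A] need not be convex. *)
Variables (U : set (R * R)) (D : R * R -> R) (L : R).
Hypotheses (mU : measurable (U : set (mR * mR))) (UA : U `<=` A).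
Hypothesis AU0 : leb2 (A `\` U) = 0%E.
Hypothesis lipH : forall x h, 0 <= h -> (forall r, 0 <= r <= h -> A (x.1 + r, x.2)) ->
  `|H (x.1 + h, x.2) - H x| <= L * h.
Hypothesis dH : forall x, U x -> (H (x.1 + h, x.2) - H x) / h @[h --> 0^'+] --> D x.

Let fU : (leb2 U < +oo)%E.
Proof.
have [b b0 Kb] := plane_compact_bounded.
pose Z : set (mR * mR) := `[- b, b]%classic `*` `[- b, b]%classic.
have mZ : measurable Z by apply: measurableX; exact: measurable_itv.
apply: (@le_lt_trans _ _ (leb2 Z)); last by rewrite leb2_box ?ltry//; lra.
apply: le_measure; rewrite ?inE// => x /UA /AK /Kb[].
by rewrite !ler_norml => h1 h2; split; rewrite /= in_itv.
Qed.

(** Apply [bad_set] along steps tending to zero and divide by the step. Off the bad sets the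
    quotients are bounded by the Lipschitz constant, and a point of [U] eventually leaves them, so
    dominated convergence applies. *)
Lemma trace_ineq_eta (eta : R) : 0 < eta -> eta <= 1 ->
  `|\int[leb2]_(x in U) D x| <= 2 * (1 + eta) *
    \sum_i \int[leb]_(t in `[0, 1]) ((`|H (g i t)| + 2 * eta) * (s i t + 2 * eta)).
Proof.
move=> eta0 eta1; set C := 2 * (1 + eta) * _.
have [d d0 Hd] := compact_unif_cont cK cH eta0.
(* The factor [1/3] keeps [2 * h n] below the modulus [d] of uniform continuity. *)
pose h (n : nat) := d / 3 * harmonic n.
have h0 n : 0 < h n by rewrite mulr_gt0 ?divr_gt0// harmonic_gt0.
have hd n : 2 * h n < d.
  have : h n <= d / 3 by rewrite /h ler_piMr ?divr_ge0 ?(ltW d0)//= invf_le1// ler1n.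
  by lra.
have hcvg : h @ \oo --> (0 : R).
  by rewrite -(mulr0 (d / 3)); apply: cvgM; [exact: cvg_cst|exact: cvg_harmonic].
have hcvgr : h @ \oo --> (0 : R)^'+.
  move=> P; rewrite /at_right /within/= => /hcvg; rewrite /nbhs/=.
  by apply: filterS => n /=; apply.
have Hn n x y : K x -> K y -> `|x.1 - y.1| <= 2 * h n -> `|x.2 - y.2| <= 2 * h n ->
    `|H x - H y| <= eta.
  move=> Kx Ky x1 x2; apply/ltW/Hd => //; rewrite prod_normE gt_max.
  by rewrite (le_lt_trans x1)// (le_lt_trans x2).
have /choice[B BP] := fun n => bad_set eta0 eta1 (h0 n) (@Hn n).
pose Ht := H \_ K; pose sh n (x : R * R) : R * R := (x.1 + h n, x.2).
pose q n x := (h n)^-1 * (Ht (sh n x) - Ht x).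
have mq n : measurable_fun setT (q n : mR * mR -> R).
  have [mHt _] := @bm_extension setT measurableT.
  apply: measurable_funM; first exact: measurable_cst.
  apply: measurable_funB => //; apply: (measurableT_comp mHt).
  apply/measurable_fun_pairP; split; last exact: measurable_snd.
  by apply: measurable_funD; [exact: measurable_fst|exact: measurable_cst].
have mBn n : measurable (B n : set (mR * mR)) by have [] := BP n.
have inA n x : A x -> ~ B n x -> A (sh n x).
  by move=> Ax nB; have [_ _ Bn _] := BP n; apply: (Bn x Ax nB (h n)); rewrite lexx (ltW (h0 n)).
have qE n x : A x -> ~ B n x -> q n x = (H (sh n x) - H x) / h n.
  move=> Ax nB; rewrite /q /Ht !patchE !mem_set 1?mulrC//; first exact: AK.
  exact/AK/inA.
pose f n := q n \_ (~` B n).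
have mf n : measurable_fun (U : set (mR * mR)) (f n : mR * mR -> R).
  apply: (@measurable_funS _ _ _ _ setT) => //.
  apply/(measurable_restrictT (q n : mR * mR -> R) (measurableC (mBn n))).
  exact: measurable_funS (mq n).
have fL n x : U x -> `|f n x| <= `|L|.
  move=> Ux; rewrite /f patchE; case: ifPn => [|_]; last by rewrite normr0.
  rewrite inE => nB; have Ax := UA Ux; rewrite qE// normrM normfV (gtr0_norm (h0 n)).
  rewrite ler_pdivrMr// (le_trans (lipH _ _)) ?(ltW (h0 n))//.
    by have [_ _ Bn _] := BP n; exact: Bn.
  by rewrite ler_pM2r// ler_norm.
have fcvg x : U x -> f ^~ x @ \oo --> D x.
  move=> Ux; have Ax := UA Ux.
  have /nbhs_ballP[e /= e0 xe] := open_nbhs_nbhs (conj oA Ax).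
  (* A bad point has a point of [K] off [A] within [2 * h n], whereas a whole ball around [x] lies
     in [A]. *)
  have ev : \forall n \near \oo, ~ B n x.
    have he : \forall n \near \oo, h n < e / 2.
      by apply: (cvgr_lt 0) => //; rewrite divr_gt0.
    apply: filterS he => n hn; have [_ + _ _] := BP n; move=> /(_ x) + Bx.
    move=> /(_ Bx)[y [_ nA x1 x2]]; apply/nA/xe.
    by split; rewrite /ball/=; [apply: le_lt_trans x1 _|apply: le_lt_trans x2 _]; lra.
  have : (H (sh n x) - H x) / h n @[n --> \oo] --> D x.
    exact: (cvg_comp _ _ hcvgr (dH Ux)).
  apply: cvg_trans; apply: near_eq_cvg; apply: filterS ev => n nB.
  by rewrite /f patchE mem_set// qE.
have cvgI := Rintegral_dominated_cvg mU fU mf fL fcvg.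
have boundI n : `|\int[leb2]_(x in U) f n x| <= C.
  have mAB : measurable (A `\` B n : set (mR * mR)) by exact: measurableD.
  have mAU : measurable (A `\` U : set (mR * mR)) by exact: measurableD.
  have -> : \int[leb2]_(x in U) f n x = \int[leb2]_(x in A `\` B n) q n x.
    rewrite [RHS](Rintegral_setD_null _ _ mAU AU0) -[LHS]Rintegral_mkcondr; congr Rintegral.
    apply/seteqP; split=> x [].
      by move=> Ux nB; split; [split=> //; exact: UA|case].
    by move=> [Ax nB] nAU; split=> //; apply: contrapT => nU; exact: nAU.
  have fAB : (leb2 (A `\` B n) < +oo)%E.
    apply: (@le_lt_trans _ _ (leb2 A)).
      by apply: le_measure; rewrite ?inE// => x [].
    have -> : A = U `|` (A `\` U) by rewrite setDUK.
    apply: le_lt_trans (measureU2 _ mU mAU) _; apply: lte_add_pinfty; first exact: fU.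
    by apply: le_lt_trans (ltry 0); rewrite le_eqVlt; apply/orP; left; apply/eqP; exact: AU0.
  have bq : bm (A `\` B n : set (mR * mR)) (fun x => H (sh n x) - H x).
    have [C' HC'] := compact_fun_bounded.
    apply: (@eq_bm _ _ _ _ (fun x => h n * q n x)).
      by move=> x [Ax nB]; rewrite qE// mulrCA divff ?mulr1// gt_eqF.
    split.
      apply: measurable_funM; first exact: measurable_cst.
      exact: measurable_funS (mq n).
    exists (C' + C') => x [Ax nB]; rewrite qE// mulrCA divff ?mulr1 ?gt_eqF//.
    by rewrite (le_trans (ler_normB _ _))// lerD// HC'//; apply: AK => //; exact: inA.
  have -> : \int[leb2]_(x in A `\` B n) q n x =
            (h n)^-1 * \int[leb2]_(x in A `\` B n) (H (sh n x) - H x).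
    rewrite -(RintegralZ_bm mAB fAB)//; apply: eq_Rintegral => x.
    by rewrite inE => -[Ax nB]; rewrite qE// mulrC.
  rewrite normrM normfV (gtr0_norm (h0 n)) mulrC ler_pdivrMr// mulrC.
  by have [_ _ _] := BP n.
have cvgN : `|\int[leb2]_(x in U) f n x| @[n --> \oo] --> `|\int[leb2]_(x in U) D x|.
  exact: cvg_norm cvgI.
rewrite -(cvg_lim _ cvgN)//; apply: limr_le; first by apply/cvg_ex; eexists; exact: cvgN.
exact: nearW.
Qed.

Theorem trace_ineq :
  `|\int[leb2]_(x in U) D x| <= 2 * \sum_i \int[leb]_(t in `[0, 1]) (`|H (g i t)| * s i t).
Proof.
have m01 : measurable (`[0, 1]%classic : set mR) by exact: measurable_itv.
have f01 := unit_itv_fin R.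
set X := `|_|; set Y := \sum_i _.
pose P := \sum_i (\int[leb]_(t in `[0, 1]) `|H (g i t)| + \int[leb]_(t in `[0, 1]) s i t).
have Y0 : 0 <= Y.
  by apply: sumr_ge0 => i _; apply: Rintegral_ge0 => t _; rewrite mulr_ge0.
have P0 : 0 <= P.
  by apply: sumr_ge0 => i _; rewrite addr_ge0//; apply: Rintegral_ge0 => t _.
have XY eta : 0 < eta -> eta <= 1 -> X <= 2 * (1 + eta) * (Y + 2 * eta * P + 4 * eta ^+ 2 * m%:R).
  move=> eta0 eta1; apply: le_trans (trace_ineq_eta eta0 eta1) _.
  rewrite ler_wpM2l ?mulr_ge0 ?addr_ge0 ?(ltW eta0)//.
  have -> : m%:R = \sum_(i < m) (1 : R) by rewrite sumr_const card_ord.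
  rewrite /Y /P !mulr_sumr -!big_split/=; apply: ler_sum => i _.
  have bHg : bm (T := mR) `[0, 1]%classic (fun t => `|H (g i t)|).
    by apply: bm_norm; apply: continuous_bm; exact: continuous_on_curve.
  have bs : bm (T := mR) `[0, 1]%classic (s i) by exact: continuous_bm.
  rewrite (_ : (fun t => (`|H (g i t)| + 2 * eta) * (s i t + 2 * eta)) =
     (fun t => `|H (g i t)| * s i t + (2 * eta * (`|H (g i t)| + s i t) + 4 * eta ^+ 2 * 1))); last first.
    by apply/funext => t; ring.
  rewrite (RintegralD_bm m01 f01); [|exact: bmM|]; last first.
    by apply: bmD; [apply: bmZ; exact: bmD|exact: bm_cst].
  rewrite (RintegralD_bm m01 f01); [|by apply: bmZ; exact: bmD|exact: bm_cst].
  rewrite (RintegralZ_bm m01 f01); [|exact: bmD].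
  rewrite (RintegralD_bm m01 f01)// Rintegral_cst//=.
  rewrite (_ : leb `[0, 1]%classic = 1%E); last first.
    by rewrite lebesgue_measure_itv/= lte_fin ltr01 -EFinB subr0.
  by rewrite mulr1 /= !mulr1 addrA.
apply/ler_addgt0Pr => e e0.
(* Since powers of [eta] are at most [eta], the excess over [2 * Y] is at most [eta * Q]; the
   summand 1 keeps [Q] positive. *)
pose Q := 2 * Y + 8 * P + 16 * m%:R + 1.
have Q0 : 0 < Q by rewrite /Q; have := ler0n R m; lra.
pose eta := Num.min 1 (e / Q).
have eta0 : 0 < eta by rewrite lt_min ltr01 divr_gt0.
have eta1 : eta <= 1 by rewrite ge_min lexx.
have etaQ : eta * Q <= e by rewrite -ler_pdivlMr// ge_min lexx orbT.
apply: le_trans (XY _ eta0 eta1) _; apply: le_trans (lerD (lexx _) etaQ).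
rewrite /Q; have m0 := ler0n R m.
have eP : eta ^+ 2 * P <= eta * P by rewrite ler_wpM2r// expr2 ger_pMr.
have e2 : eta ^+ 2 * m%:R <= eta * m%:R by rewrite ler_wpM2r// expr2 ger_pMr.
have e3 : eta ^+ 3 * m%:R <= eta * m%:R.
  by rewrite ler_wpM2r// exprS ger_pMr// exprn_ile1// ltW.
have -> : 2 * (1 + eta) * (Y + 2 * eta * P + 4 * eta ^+ 2 * m%:R) =
  2 * Y + 2 * (eta * Y) + 4 * (eta * P) + 4 * (eta ^+ 2 * P) + 8 * (eta ^+ 2 * m%:R) + 8 * (eta ^+ 3 * m%:R) by ring.
have -> : 2 * Y + eta * (2 * Y + 8 * P + 16 * m%:R + 1) =
  2 * Y + 2 * (eta * Y) + 8 * (eta * P) + 16 * (eta * m%:R) + eta by ring.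
lra.
Qed.

End Trace.

Lemma continuous_swap (R : realType) : continuous (fun x : R * R => (x.2, x.1)).
Proof. by move=> x; exact: (cvg_pair cvg_snd cvg_fst). Qed.

(** Exchange the coordinates: this preserves the plane measure and carries the hypotheses to those
    of [trace_ineq]. *)
Theorem trace_ineq_snd (R : realType) (A K : set (R * R)) (m : nat) (g : 'I_m -> R -> R * R)
    (s : 'I_m -> R -> R) (H : R * R -> R) (oA : open A) (cK : compact K) (AK : A `<=` K)
    (KA : forall x, K x -> ~ A x -> exists i t, 0 <= t <= 1 /\ x = g i t)
    (gK : forall i t, K (g i t) /\ ~ A (g i t))
    (dg1 : forall i t, derivable (fst \o g i) t 1)
    (dg2 : forall i t, derivable (snd \o g i) t 1) (cs : forall i, continuous (s i))
    (gs1 : forall i t, `|derive1 (fst \o g i) t| <= s i t)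
    (gs2 : forall i t, `|derive1 (snd \o g i) t| <= s i t)
    (cH : {within K, continuous H}) (U : set (R * R)) (D : R * R -> R) (L : R)
    (mU : measurable (U : set (measurableTypeR R * measurableTypeR R))) (UA : U `<=` A)
    (AU0 : ((@lebesgue_measure R) \x (@lebesgue_measure R))%E (A `\` U) = 0%E)
    (mD : measurable_fun (U : set (measurableTypeR R * measurableTypeR R)) D)
    (lipH : forall x h, 0 <= h -> (forall r, 0 <= r <= h -> A (x.1, x.2 + r)) ->
      `|H (x.1, x.2 + h) - H x| <= L * h)
    (dH : forall x, U x -> (H (x.1, x.2 + h) - H x) / h @[h --> 0^'+] --> D x) :
  `|\int[((@lebesgue_measure R) \x (@lebesgue_measure R))%E]_(x in U) D x| <=
  2 * \sum_i \int[lebesgue_measure]_(t in `[0, 1]) (`|H (g i t)| * s i t).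
Proof.
pose w (x : R * R) := (x.2, x.1).
have ww x : w (w x) = x by rewrite /w -surjective_pairing.
have cw : continuous w := @continuous_swap R.
have clK : closed K by apply: compact_closed cK; exact: norm_hausdorff.
rewrite -(Rintegral_leb2_swap mU mD).
have oA' : open (w @^-1` A) by apply: open_comp => // x _; exact: cw.
have cK' : compact (w @^-1` K).
  have -> : w @^-1` K = w @` K.
    by apply/seteqP; split=> [x Kx|_ [x Kx <-]]; [exists (w x); rewrite ?ww|rewrite /= ww].
  by apply: continuous_compact => //; exact: continuous_subspaceT.
have cH' : {within w @^-1` K, continuous (H \o w)}.
  apply/subspace_continuousP => x Kx; move/subspace_continuousP : cH => /(_ _ Kx) cHx.
  apply: cvg_trans cHx => P /= wP.
  suff : \forall y \near x, K (w y) -> P (H (w y)) by [].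
  exact: (cw x _ wP).
have mw (B : set (R * R)) : measurable (B : set (measurableTypeR R * measurableTypeR R)) ->
    measurable (w @^-1` B : set (measurableTypeR R * measurableTypeR R)).
  by move=> mB; rewrite -[X in measurable X]setTI; exact: (@measurable_swap_plane R).
have -> : \sum_i \int[lebesgue_measure]_(t in `[0, 1]) (`|H (g i t)| * s i t) =
    \sum_i \int[lebesgue_measure]_(t in `[0, 1]) (`|(H \o w) (w (g i t))| * s i t).
  by apply: eq_bigr => i _; apply: eq_Rintegral => t _; rewrite /= ww.
apply: (@trace_ineq R (w @^-1` A) (w @^-1` K) m (fun i t => w (g i t)) s (H \o w) oA' cK'
   _ _ _ _ _ cs _ _ cH' (w @^-1` U) (D \o w) L) => //.
- by move=> x; exact: AK.
- move=> x Kx nA; have [i [t [t01 wx]]] := KA _ Kx nA; exists i, t; split=> //.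
  by rewrite -wx ww.
- by move=> i t; rewrite /= !ww; exact: gK.
- exact: mw.
- by move=> x; exact: UA.
- rewrite -[LHS]/(((@lebesgue_measure R) \x (@lebesgue_measure R))%E (w @^-1` (A `\` U))).
  rewrite leb2_swap//; apply: measurableD => //; exact: open_measurable_plane.
- by move=> x h h0 Ax; have := lipH (w x) h h0 Ax; rewrite /=.
- by move=> x Ux; exact: (dH (w x) Ux).
Qed.

(** * The trace inequality on a smooth domain *)

Section SmoothDomain.
Variable R : realType.
Variable Om : smooth_domain R.
Local Notation leb := (@lebesgue_measure R).
Local Notation leb2 := (leb \x leb)%E.
Local Notation mR := (measurableTypeR R).
Local Notation A := (dom Om).
Local Notation K := (closure (dom Om)).

Lemma dom_compact_closure : compact K.
Proof.
have [M [_ AM]] := dom_bounded Om.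
pose b := `|M| + 1; pose Z : set (R * R) := `[- b, b]%classic `*` `[- b, b]%classic.
have cZ : compact Z by apply: compact_setX; exact: segment_compact.
apply: (subclosed_compact _ cZ); first exact: closed_closure.
have clZ : closed Z by apply: compact_closed cZ; exact: norm_hausdorff.
rewrite ((closure_id Z).1 clZ); apply: closure_subset => x Ax.
have : `|x| <= b by apply: AM => //; rewrite ltr_pwDr// ler_norm.
by rewrite prod_normE ge_max !ler_norml => /andP[h1 h2]; split; rewrite /= in_itv.
Qed.

Lemma smooth_derivable (f : R -> R) t : smooth f -> derivable f t 1.
Proof. by move=> /(_ 0%N t). Qed.

Lemma smooth_derive1_continuous (f : R -> R) : smooth f -> continuous (derive1 f).
Proof.
move=> sf t; apply: differentiable_continuous; apply/derivable1_diffP.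
exact: (sf 1%N t).
Qed.

Lemma continuous_speed i : continuous (speed (@bcurve R Om i)).
Proof.
have [s1 s2 _ _ _] := @bcurve_smooth R Om i.
have c1 := smooth_derive1_continuous s1; have c2 := smooth_derive1_continuous s2.
have -> : speed (bcurve i) = Num.sqrt \o
    (fun t => derive1 (fst \o bcurve i) t * derive1 (fst \o bcurve i) t +
              derive1 (snd \o bcurve i) t * derive1 (snd \o bcurve i) t).
  by apply/funext => t; rewrite /speed /= !expr2.
move=> t; apply: continuous_comp; last exact: sqrt_continuous.
exact: (continuousD (continuousM (c1 t) (c1 t)) (continuousM (c2 t) (c2 t))).
Qed.

Lemma speed_ge i t : `|derive1 (fst \o @bcurve R Om i) t| <= speed (bcurve i) t /\
  `|derive1 (snd \o @bcurve R Om i) t| <= speed (bcurve i) t.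
Proof.
by rewrite /speed -!sqrtr_sqr; split; apply: ler_wsqrtr; rewrite ?lerDl ?lerDr sqr_ge0.
Qed.

Lemma bcurve_in i t : K (@bcurve R Om i t) /\ ~ A (bcurve i t).
Proof.
have : (K `\` A) (@bcurve R Om i t) by rewrite bcurve_boundary; exists i => //; exists t.
by [].
Qed.

Lemma bcurve_cover x : K x -> ~ A x -> exists i t, 0 <= t <= 1 /\ x = @bcurve R Om i t.
Proof.
move=> Kx nA; have : (K `\` A) x by [].
rewrite bcurve_boundary => -[i _ [t _ <-]].
have [_ _ _ per _] := @bcurve_smooth R Om i.
have perN n u : bcurve i (u + n%:R) = bcurve i u.
  elim: n u => [|n IH] u; first by rewrite addr0.
  by rewrite -natr1 addrA per IH.
have perZ (n : int) u : bcurve i (u + n%:~R) = bcurve i u.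
  case: n => n; first by rewrite -pmulrn perN.
  by rewrite NegzE mulrNz -[LHS](perN n.+1) (_ : n.+1%:~R = n.+1%:R)// subrK.
(* Periodicity brings the parameter back to the unit interval. *)
exists i, (t - (Num.floor t)%:~R); split.
  have := real_floor_itv (num_real t); rewrite intrD1 => /andP[h1 h2].
  by apply/andP; split; lra.
by rewrite -[RHS](perZ (Num.floor t)) subrK.
Qed.

Lemma leb2_dom_fin : (leb2 A < +oo)%E.
Proof.
have [b b0 Kb] := plane_compact_bounded dom_compact_closure.
pose Z : set (mR * mR) := `[- b, b]%classic `*` `[- b, b]%classic.
have mZ : measurable Z by apply: measurableX; exact: measurable_itv.
apply: (@le_lt_trans _ _ (leb2 Z)); last by rewrite leb2_box ?ltry//; lra.
have mA : measurable (A : set (mR * mR)).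
  by apply: open_measurable_plane; exact: dom_open.
apply: le_measure; rewrite ?inE// => x /subset_closure /Kb[].
by rewrite !ler_norml => h1 h2; split; rewrite /= in_itv.
Qed.

Section TraceDomain.
Variables (H D : R * R -> R) (L : R) (U : set (R * R)).
Hypotheses (cH : {within K, continuous H}).
Hypotheses (mU : measurable (U : set (mR * mR))) (UA : U `<=` A).
Hypothesis AU0 : leb2 (A `\` U) = 0%E.

Lemma trace_dom1 :
  (forall x h, 0 <= h -> (forall r, 0 <= r <= h -> A (x.1 + r, x.2)) ->
    `|H (x.1 + h, x.2) - H x| <= L * h) ->
  (forall x, U x -> (H (x.1 + h, x.2) - H x) / h @[h --> 0^'+] --> D x) ->
  `|\int[leb2]_(x in U) D x| <= 2 * int_bd Om (fun x => `|H x|).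
Proof.
move=> lipH dH; apply: (@trace_ineq R A K _ (@bcurve R Om) (fun i => speed (bcurve i)) H
  _ dom_compact_closure _ _ _ _ _ _ _ _ cH U D L) => //.
- exact: dom_open.
- exact: subset_closure.
- exact: bcurve_cover.
- exact: bcurve_in.
- by move=> i t; apply: smooth_derivable; have [] := @bcurve_smooth R Om i.
- by move=> i t; apply: smooth_derivable; have [] := @bcurve_smooth R Om i.
- exact: continuous_speed.
- by move=> i t; have [] := speed_ge i t.
- by move=> i t; have [] := speed_ge i t.
Qed.

Lemma trace_dom2 : measurable_fun (U : set (mR * mR)) D ->
  (forall x h, 0 <= h -> (forall r, 0 <= r <= h -> A (x.1, x.2 + r)) ->
    `|H (x.1, x.2 + h) - H x| <= L * h) ->
  (forall x, U x -> (H (x.1, x.2 + h) - H x) / h @[h --> 0^'+] --> D x) ->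
  `|\int[leb2]_(x in U) D x| <= 2 * int_bd Om (fun x => `|H x|).
Proof.
move=> mD lipH dH; apply: (@trace_ineq_snd R A K _ (@bcurve R Om) (fun i => speed (bcurve i)) H
  _ dom_compact_closure _ _ _ _ _ _ _ _ cH U D L) => //.
- exact: dom_open.
- exact: subset_closure.
- exact: bcurve_cover.
- exact: bcurve_in.
- by move=> i t; apply: smooth_derivable; have [] := @bcurve_smooth R Om i.
- by move=> i t; apply: smooth_derivable; have [] := @bcurve_smooth R Om i.
- exact: continuous_speed.
- by move=> i t; have [] := speed_ge i t.
- by move=> i t; have [] := speed_ge i t.
Qed.

End TraceDomain.

Lemma bm_bcurve (H : R * R -> R) i : {within K, continuous H} ->
  bm (T := mR) `[0, 1]%classic (fun t => H (@bcurve R Om i t)).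
Proof.
move=> cH; apply: continuous_bm.
apply: (continuous_on_curve (g := @bcurve R Om) bcurve_in _ _ cH).
- by move=> j t; apply: smooth_derivable; have [] := @bcurve_smooth R Om j.
- by move=> j t; apply: smooth_derivable; have [] := @bcurve_smooth R Om j.
Qed.

Lemma bm_speed i : bm (T := mR) `[0, 1]%classic (speed (@bcurve R Om i)).
Proof. by apply: continuous_bm; exact: continuous_speed. Qed.

End SmoothDomain.

(** * Finite element functions *)

Section LocallyAffine.
Variable R : realType.
Implicit Types (f : R * R -> R) (x : R * R).

Definition affine_near f x := exists a b c : R,
  \forall y \near x, f y = a + b * y.1 + c * y.2.

Lemma near_at_right (P : set R) (t : R) :
  (\forall h \near t, P h) -> \forall h \near t^'+, P h.
Proof.
move=> Pt; suff : \forall h \near t, t < h -> P h by [].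
by apply: filterS Pt => h.
Qed.

Lemma near_hline (P : set (R * R)) x : (\forall y \near x, P y) ->
  \forall h \near (0 : R), P (x.1 + h, x.2).
Proof.
move=> Px.
have c1 : {for 0, continuous (fun h : R => x.1 + h)}.
  by apply: continuousD; [exact: cst_continuous|exact: cvg_id].
have C : (x.1 + h, x.2) @[h --> (0 : R)] --> (x.1 + 0, x.2).
  exact: (cvg_pair c1 (@cst_continuous _ _ x.2 (0 : R))).
by move: C; rewrite addr0 -surjective_pairing => /(_ _ Px).
Qed.

Lemma near_vline (P : set (R * R)) x : (\forall y \near x, P y) ->
  \forall h \near (0 : R), P (x.1, x.2 + h).
Proof.
move=> Px.
have c2 : {for 0, continuous (fun h : R => x.2 + h)}.
  by apply: continuousD; [exact: cst_continuous|exact: cvg_id].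
have C : (x.1, x.2 + h) @[h --> (0 : R)] --> (x.1, x.2 + 0).
  exact: (cvg_pair (@cst_continuous _ _ x.1 (0 : R)) c2).
by move: C; rewrite addr0 -surjective_pairing => /(_ _ Px).
Qed.

Lemma derive1_near_affine (phi : R -> R) (t w b : R) :
  (\forall h \near (0 : R), phi (t + h) = w + b * h) -> derive1 phi t = b.
Proof.
move=> phiE; have phi0 : phi t = w by have := nbhs_singleton phiE; rewrite addr0 mulr0 addr0.
rewrite /derive1; apply: cvg_lim => //.
apply: cvg_near_cst.
suff : \forall h \near (0 : R), h != 0 -> h^-1 *: (phi (h + t) - phi t) = b by [].
apply: filterS phiE => h + h0; rewrite addrC => ->.
by rewrite phi0 addrAC subrr add0r /GRing.scale/= mulrC mulfK.
Qed.

(** Factoring the difference of powers turns the quotient into a polynomial in [h], continuous at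
    0. *)
Lemma exp_quotient_near_affine (phi : R -> R) (w b : R) (m : nat) :
  (\forall h \near (0 : R), phi h = w + b * h) ->
  (phi h ^+ m.+1 - phi 0 ^+ m.+1) / h @[h --> 0^'+] --> m.+1%:R * w ^+ m * b.
Proof.
move=> phiE; have phi0 : phi 0 = w by have := nbhs_singleton phiE; rewrite mulr0 addr0.
pose q h := b * \sum_(i < m.+1) (w + b * h) ^+ (m.+1.-1 - i) * w ^+ i.
have q0 : q 0 = m.+1%:R * w ^+ m * b.
  rewrite /q mulr0 addr0 mulrC; congr (_ * b).
  rewrite (eq_bigr (fun=> w ^+ m)); first by rewrite sumr_const card_ord mulr_natl.
  by move=> i _; rewrite -exprD subnK// -ltnS.
have cq : {for 0, continuous q}.
  have k (r h : R) : {for h, continuous (fun _ : R => r)} by exact: cst_continuous.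
  have cl h : {for h, continuous (fun h => w + b * h)}.
    exact: (continuousD (k w h) (continuousM (k b h) cvg_id)).
  have cS : continuous (fun h => \sum_(i < m.+1) (w + b * h) ^+ (m.+1.-1 - i) * w ^+ i).
    apply: (@continuous_sum R R R) => i h.
    have ce := continuous_comp (cl h) (@exprn_continuous R (m.+1.-1 - i) (w + b * h)).
    exact: (continuousM ce (k (w ^+ i) h)).
  exact: (continuousM (k b 0) (cS 0)).
rewrite -q0; have : q h @[h --> 0^'+] --> q 0 by apply: cvg_at_right_filter; exact: cq.
apply: cvg_trans; apply: near_eq_cvg.
apply: filterS2 (nbhs_right_gt (0 : R)) (near_at_right phiE) => h h0 ->.
rewrite phi0 subrXX /q; set S := \sum_(_ < _) _; field.
by rewrite gt_eqF.
Qed.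

Lemma affine_near_pd f x a b c : (\forall y \near x, f y = a + b * y.1 + c * y.2) ->
  pd1 f x = b /\ pd2 f x = c.
Proof.
move=> fE; split; rewrite /pd1 /pd2.
  apply: (@derive1_near_affine _ _ (f x)); have /= := near_hline fE.
  apply: filterS => h ->; rewrite (nbhs_singleton fE); ring.
apply: (@derive1_near_affine _ _ (f x)); have /= := near_vline fE.
by apply: filterS => h ->; rewrite (nbhs_singleton fE); ring.
Qed.

Lemma affine_nearP f x : affine_near f x ->
  (\forall h \near (0 : R), f (x.1 + h, x.2) = f x + pd1 f x * h) /\
  (\forall h \near (0 : R), f (x.1, x.2 + h) = f x + pd2 f x * h).
Proof.
move=> [a [b [c fE]]]; have [-> ->] := affine_near_pd fE; split.
  by have /= := near_hline fE; apply: filterS => h ->; rewrite (nbhs_singleton fE); ring.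
by have /= := near_vline fE; apply: filterS => h ->; rewrite (nbhs_singleton fE); ring.
Qed.

Lemma affine_near_near f x : affine_near f x -> \forall y \near x,
  [/\ affine_near f y, pd1 f y = pd1 f x & pd2 f y = pd2 f x].
Proof.
move=> [a [b [c fE]]]; have [-> ->] := affine_near_pd fE.
have N : \forall y \near x, \forall z \near y, f z = a + b * z.1 + c * z.2.
  exact: (nbhs_interior fE).
near=> y; have fy : \forall z \near y, f z = a + b * z.1 + c * z.2 by near: y.
by have [-> ->] := affine_near_pd fy; split=> //; exists a, b, c.
Unshelve. all: by end_near. Qed.

Lemma affine_near_lin (I : Type) (s : seq I) (F : I -> R * R -> R) (w : I -> R) x :
  (forall i, affine_near (F i) x) ->
  [/\ affine_near (fun y => \sum_(i <- s) w i * F i y) x,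
    pd1 (fun y => \sum_(i <- s) w i * F i y) x = \sum_(i <- s) w i * pd1 (F i) x &
    pd2 (fun y => \sum_(i <- s) w i * F i y) x = \sum_(i <- s) w i * pd2 (F i) x].
Proof.
move=> aF.
have [a E] : exists a, \forall y \near x, \sum_(i <- s) w i * F i y =
    a + (\sum_(i <- s) w i * pd1 (F i) x) * y.1 + (\sum_(i <- s) w i * pd2 (F i) x) * y.2.
  elim: s => [|i s [a IH]].
    by exists 0; near=> y; rewrite !big_nil; ring.
  have [ai [bi [ci Fi]]] := aF i; have [p1 p2] := affine_near_pd Fi.
  exists (a + w i * ai); near=> y.
  rewrite !big_cons (_ : F i y = ai + bi * y.1 + ci * y.2); last by near: y.
  rewrite (_ : \sum_(j <- s) w j * F j y = a + (\sum_(j <- s) w j * pd1 (F j) x) * y.1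
    + (\sum_(j <- s) w j * pd2 (F j) x) * y.2); last by near: y.
  by rewrite p1 p2; ring.
have [p1 p2] := affine_near_pd E; split=> //.
by exists a; do 2 eexists; exact: E.
Unshelve. all: by end_near. Qed.

End LocallyAffine.

(** Induction on the number of sets: let [t] be the last point of [[a, b]] in a set [E i] containing
    [a]. The hypothesis compares [a] with [t] directly, however often the path leaves [E i] in
    between, and the other sets cover [[t, b]]. *)
Lemma closed_cover_lipschitz (R : realType) (I : eqType) (s : seq I) (E : I -> set R)
    (phi : R -> R) (L b : R) :
  (forall i, closed (E i)) ->
  (forall i r r', E i r -> E i r' -> `|phi r - phi r'| <= L * `|r - r'|) ->
  forall a, a <= b -> (forall r, a <= r <= b -> exists2 i, i \in s & E i r) ->
  `|phi b - phi a| <= L * (b - a).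
Proof.
move=> cE lip; elim: {s}(size s) {-2}s (erefl (size s)) => [|n IH] s sn a ab cov.
  by have [|i] := cov a; rewrite ?lexx// (size0nil sn).
have [i is_ Ea] : exists2 i, i \in s & E i a by apply: cov; rewrite lexx.
pose S := E i `&` `[a, b]%classic.
have Sa : S a by split=> //=; rewrite in_itv/= lexx.
have hS : has_sup S.
  by split; [exists a|exists b => r [_] /=; rewrite in_itv/= => /andP[]].
have cS : closed S by apply: closedI; [exact: cE|exact: interval_closed].
pose t := sup S; have [Et] : S t by rewrite ((closure_id S).1 cS); apply: closure_sup; [exists a|have [] := hS].
rewrite /= in_itv/= => /andP[at_ tb].
have step1 : `|phi t - phi a| <= L * (t - a).
  by have := lip i t a Et Ea; rewrite (ger0_norm (_ : 0 <= t - a)) ?subr_ge0.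
have [tbE|tb'] := eqVneq t b; first by rewrite -tbE.
have tltb : t < b by rewrite lt_neqAle tb'.
have rm j : j \in s -> j != i -> j \in rem i s.
  by move=> js ji; have := perm_mem (perm_to_rem is_) j; rewrite js inE (negbTE ji).
have cov' r : t < r <= b -> exists2 j, j \in rem i s & E j r.
  move=> /andP[tr rb]; have ar : a <= r by exact: le_trans at_ (ltW tr).
  have [|j js Ej] := cov r; first by rewrite ar.
  exists j => //; apply: rm => //; apply: contraTneq tr => ji.
  rewrite -leNgt; apply: ub_le_sup; first by have [] := hS.
  by rewrite ji in Ej; split=> //=; rewrite in_itv/= rb ar.
have s'n : size (rem i s) = n by rewrite size_rem// sn.
(* At [t] itself closedness is used: other sets all missing [t] would also miss the points just to
   its right, which they cover. *)
have covt : exists2 j, j \in rem i s & E j t.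
  apply: contrapT => nE.
  have : \forall r \near (t : R), forall j, j \in rem i s -> ~ E j r.
    have : forall j, j \in rem i s -> ~ E j t by move=> j js Ej; apply: nE; exists j.
    elim: (rem i s) => [|j l IHl] nEl; first by near=> r.
    have nj : \forall r \near (t : R), ~ E j r.
      apply: open_nbhs_nbhs; split; first exact/closed_openC.
      by apply: nEl; rewrite inE eqxx.
    have nl := IHl (fun k kl => nEl k (mem_behead (s := j :: l) kl)).
    near=> r; move=> k; rewrite inE => /predU1P[->|]; first by near: r.
    by move: k; near: r.
  move=> /near_at_right /(filterI (nbhs_right_le tltb)).
  move=> /(filterI (nbhs_right_gt t)) /filter_ex[r [tr [rb nEr]]].
  by have [|j js Ej] := cov' r; [rewrite tr|exact: nEr Ej].
have step2 : `|phi b - phi t| <= L * (b - t).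
  apply: (IH _ s'n) => // r /andP[tr rb].
  by have [<-//|tr'] := eqVneq t r; apply: cov'; rewrite lt_neqAle tr' tr.
have -> : phi b - phi a = (phi b - phi t) + (phi t - phi a) by ring.
rewrite (le_trans (ler_normD _ _))// (_ : L * (b - a) = L * (b - t) + L * (t - a)); last ring.
by rewrite lerD.
Unshelve. all: by end_near. Qed.

Lemma measure_bigsetU_null d (T : measurableType d) (R : realType)
    (mu : {measure set T -> \bar R}) (I : eqType) (s : seq I) (F : I -> set T) :
  (forall i, measurable (F i) /\ mu (F i) = 0%E) ->
  measurable (\big[setU/set0]_(i <- s) F i) /\ mu (\big[setU/set0]_(i <- s) F i) = 0%E.
Proof.
move=> F0; elim: s => [|i s [mIH IH]]; first by rewrite big_nil measure0.
have [mFi Fi0] := F0 i; rewrite big_cons; split; first exact: measurableU.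
by rewrite measureU0.
Qed.

Lemma expr_lipschitz (R : realType) (m : nat) (a b B : R) : `|a| <= B -> `|b| <= B ->
  `|a ^+ m.+1 - b ^+ m.+1| <= m.+1%:R * B ^+ m * `|a - b|.
Proof.
move=> aB bB; have B0 : 0 <= B by exact: le_trans aB.
rewrite subrXX normrM mulrC ler_wpM2r// (le_trans (ler_norm_sum _ _ _))//.
rewrite mulr_natl -[X in _ *+ X](card_ord m.+1) -sumr_const; apply: ler_sum => i _.
rewrite normrM !normrX (_ : B ^+ m = B ^+ (m.+1.-1 - i) * B ^+ i).
  by apply: ler_pM; rewrite ?exprn_ge0//; apply: lerXn2r; rewrite ?nnegrE.
by rewrite -exprD subnK// -ltnS.
Qed.

Section FiniteElements.
Variables (R : realType) (Om : smooth_domain R) (Th : triangulation Om).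
Local Notation leb := (@lebesgue_measure R).
Local Notation leb2 := (leb \x leb)%E.
Local Notation mR := (measurableTypeR R).
Local Notation A := (dom Om).
Local Notation K := (closure (dom Om)).
Implicit Types f : R * R -> R.

Let mA : measurable (A : set (mR * mR)).
Proof. by apply: open_measurable_plane; exact: dom_open. Qed.

Lemma Vh_coef f : Vh Th f -> exists co : 'I_(ntri Th) -> R * R * R,
  forall i x, @elt R Om Th i x -> f x = (co i).1.1 + (co i).1.2 * x.1 + (co i).2 * x.2.
Proof.
move=> [_ fP].
have /choice[co coE] : forall i, exists co : R * R * R, forall x, @elt R Om Th i x ->
    f x = co.1.1 + co.1.2 * x.1 + co.2 * x.2.
  by move=> i; have [a [b [c fE]]] := fP i; exists (a, b, c).
by exists co.
Qed.

Lemma Vh_continuous_at f x : {within K, continuous f} -> A x -> {for x, continuous f}.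
Proof.
move=> /subspace_continuousP cf Ax; have Kx : K x by exact: subset_closure.
have := cf x Kx; apply: cvg_trans => P wP.
have AK : \forall y \near x, K y.
  have : \forall y \near x, A y by apply: open_nbhs_nbhs; split=> //; exact: dom_open.
  by apply: filterS; exact: subset_closure.
suff : \forall y \near x, P (f y) by [].
have {}wP : \forall y \near x, K y -> P (f y) by exact: wP.
by near=> y; have Ky : K y; [near: y|move: Ky; near: y].
Unshelve. all: by end_near. Qed.

(* The elements need not have null boundary: [f] is locally affine because it is
   a continuous selection of finitely many affine functions. *)
Lemma Vh_affine_off_lines f (co : 'I_(ntri Th) -> R * R * R) x :
  {within K, continuous f} ->
  (forall i x, @elt R Om Th i x -> f x = (co i).1.1 + (co i).1.2 * x.1 + (co i).2 * x.2) ->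
  A x -> (forall i j, co i != co j ->
    ((co i).1.1 - (co j).1.1) + ((co i).1.2 - (co j).1.2) * x.1 +
    ((co i).2 - (co j).2) * x.2 != 0) -> affine_near f x.
Proof.
move=> cf fE Ax off; have Kx : K x by exact: subset_closure.
have [i _ ix] : (\bigcup_i @elt R Om Th i) x by rewrite (elt_cover Th).
exists (co i).1.1, (co i).1.2, (co i).2.
have far j : \forall y \near x, elt j y -> co j = co i.
  have [cij|cij] := eqVneq (co j) (co i); first by near=> y.
  have : f x - ((co j).1.1 + (co j).1.2 * x.1 + (co j).2 * x.2) != 0.
    by rewrite (fE _ _ ix); have := off i j; rewrite eq_sym => /(_ cij); apply: contra_neq; lra.
  move=> nz; have cd : {for x, continuous (fun y => f y -
      ((co j).1.1 + (co j).1.2 * y.1 + (co j).2 * y.2))}.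
    apply: continuousB; first exact: Vh_continuous_at.
    exact: continuous_affine_plane.
  have : \forall y \near x, f y - ((co j).1.1 + (co j).1.2 * y.1 + (co j).2 * y.2) != 0.
    exact: (cvgr_neq0 _ cd nz).
  move=> nzy; near=> y => jy.
  have : f y - ((co j).1.1 + (co j).1.2 * y.1 + (co j).2 * y.2) != 0 by near: y.
  by rewrite (fE _ _ jy) subrr eqxx.
have {}far : \forall y \near x, forall j, elt j y -> co j = co i.
  exact: (@filter_forall _ _ (fun j y => @elt R Om Th j y -> co j = co i) _ _ far).
have nA : \forall y \near x, A y by apply: open_nbhs_nbhs; split=> //; exact: dom_open.
near=> y; have Ay : A y by near: y.
have [j _ jy] : (\bigcup_i @elt R Om Th i) y by rewrite (elt_cover Th); exact: subset_closure.
have <- : co j = co i by move: j jy; near: y.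
exact: fE.
Unshelve. all: by end_near. Qed.

(** The elements cut the parameter interval into closed sets on which [f \o p] is the restriction of
    an affine function; a sum of the slopes over all elements serves as a common Lipschitz
    constant. *)
Lemma Vh_lipschitz f : Vh Th f -> exists2 L, 0 <= L & forall (p : R -> R * R) h, 0 <= h ->
  continuous p -> (forall r r', `|(p r).1 - (p r').1| <= `|r - r'| /\
    `|(p r).2 - (p r').2| <= `|r - r'|) ->
  (forall r, 0 <= r <= h -> K (p r)) -> `|f (p h) - f (p 0)| <= L * h.
Proof.
move=> /Vh_coef[co fE]; exists (\sum_i (`|(co i).1.2| + `|(co i).2|)).
  by apply: sumr_ge0 => i _; rewrite addr_ge0.
move=> p h h0 cp lp Kp; rewrite -[in leRHS](subr0 h).
apply: (@closed_cover_lipschitz R _ (enum 'I_(ntri Th)) (fun i => p @^-1` @elt R Om Th i) (f \o p)) => //.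
- by move=> i; apply: preimage_closed; [move=> x _; exact: cp|exact: elt_closed].
- move=> i r r' ir ir'; rewrite /= (fE _ _ ir) (fE _ _ ir').
  rewrite (bigD1 i)//= mulrDl (le_trans (_ : _ <= (`|(co i).1.2| + `|(co i).2|) * `|r - r'|))//.
    have -> : (co i).1.1 + (co i).1.2 * (p r).1 + (co i).2 * (p r).2 -
      ((co i).1.1 + (co i).1.2 * (p r').1 + (co i).2 * (p r').2) =
      (co i).1.2 * ((p r).1 - (p r').1) + (co i).2 * ((p r).2 - (p r').2) by ring.
    have [l1 l2] := lp r r'.
    by rewrite (le_trans (ler_normD _ _))// !normrM mulrDl lerD// ler_wpM2l.
  by rewrite lerDl mulr_ge0// sumr_ge0// => j _; rewrite addr_ge0.
- move=> r rh; have : (\bigcup_i @elt R Om Th i) (p r) by rewrite (elt_cover Th); exact: Kp.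
  by move=> [i _ ir]; exists i => //; rewrite mem_enum.
Qed.

(** One set for the whole family, so that all integrals of combinations of the [e i] are taken over
    the same domain. *)
Definition regular_set (I : Type) (e : I -> R * R -> R) : set (R * R) :=
  [set x | A x /\ forall i, affine_near (e i) x].

Lemma regular_set_open (I : finType) (e : I -> R * R -> R) : open (regular_set e).
Proof.
rewrite openE => x [Ax ex]; rewrite /interior.
have nA : \forall y \near x, A y by apply: open_nbhs_nbhs; split=> //; exact: dom_open.
have ne i : \forall y \near x, affine_near (e i) y.
  have := affine_near_near (ex i) => h.
  near=> y; have [] // : [/\ affine_near (e i) y, pd1 (e i) y = pd1 (e i) x
     & pd2 (e i) y = pd2 (e i) x] by near: y.
have {}ne : \forall y \near x, forall i, affine_near (e i) y.
  exact: (@filter_forall _ _ (fun i y => affine_near (e i) y) _ _ ne).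
by near=> y; split; near: y.
Unshelve. all: by end_near. Qed.

(** Irregular points of [A] lie on the finitely many lines where two distinct affine pieces of the
    same [e i] agree. *)
Lemma regular_set_null (I : finType) (e : I -> R * R -> R) : (forall i, Vh Th (e i)) ->
  leb2 (A `\` regular_set e) = 0%E.
Proof.
move=> eV; have /choice[co coE] := fun i => Vh_coef (eV i).
pose line (p : I * 'I_(ntri Th) * 'I_(ntri Th)) : set (mR * mR) :=
  if co p.1.1 p.1.2 == co p.1.1 p.2 then set0 else
  [set x | ((co p.1.1 p.1.2).1.1 - (co p.1.1 p.2).1.1) +
    ((co p.1.1 p.1.2).1.2 - (co p.1.1 p.2).1.2) * x.1 +
    ((co p.1.1 p.1.2).2 - (co p.1.1 p.2).2) * x.2 = 0].
have line0 p : measurable (line p) /\ leb2 (line p) = 0%E.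
  rewrite /line; case: eqP => [_|cc]; first by split=> //; rewrite measure0.
  split; first by apply: closed_measurable_plane; exact: closed_line.
  apply: leb2_line; apply/eqP => -[/subr0_eq h1 /subr0_eq h2 /subr0_eq h3]; apply: cc.
  by rewrite [LHS]surjective_pairing [RHS]surjective_pairing h3; congr (_, _);
    rewrite [LHS]surjective_pairing [RHS]surjective_pairing h1 h2.
have [mN N0] := measure_bigsetU_null (enum {: I * 'I_(ntri Th) * 'I_(ntri Th)}) line0.
apply: (@subset_measure0 _ _ R leb2 _ _ _ _ _ N0) => //.
- apply: measurableD => //; apply: open_measurable_plane; exact: regular_set_open.
- move=> x [Ax nr]; apply: contrapT => noff; apply: nr; split=> // i.
  apply: (Vh_affine_off_lines (eV i).1 (coE i) Ax) => j k cjk; apply/eqP => z.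
  apply: noff; rewrite -bigcup_seq; exists (i, j, k) => /=; first by rewrite mem_enum.
  by rewrite /line/= (negbTE cjk).
Qed.

End FiniteElements.

(** [X] and [Y] are the drift and convection terms, [S1] to [S4] the integrals of the partial
    derivatives of [f^2] and [f^3], [Q2] and [Q3] the boundary integrals of [|f|^2] and [|f|^3], [G]
    the diffusion term and [r] the remaining boundary integral. *)
Lemma energy_arith (R : realType) (X Y S1 S2 S3 S4 Q2 Q3 wd G r : R) :
  2 * X = S1 + S2 -> 3 * Y = S3 + S4 -> `|S1| <= 2 * Q2 -> `|S2| <= 2 * Q2 ->
  `|S3| <= 2 * Q3 -> `|S4| <= 2 * Q3 -> 0 <= wd -> 0 <= G -> 0 <= r ->
  0 <= G + wd * X + Y + (2 * wd * Q2 + (4 / 3 * Q3 + r)).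
Proof.
rewrite !ler_norml => e1 e2 /andP[h1 _] /andP[h2 _] /andP[h3 _] /andP[h4 _] wd0 G0 r0.
have XQ : - (2 * Q2) <= X by lra.
have := ler_wpM2l wd0 XQ; rewrite mulrN mulrCA mulrA => h5.
lra.
Qed.

(** * The energy estimate *)

Section Energy.
Variables (R : realType) (Om : smooth_domain R) (Th : triangulation Om).
Local Notation leb := (@lebesgue_measure R).
Local Notation leb2 := (leb \x leb)%E.
Local Notation mR := (measurableTypeR R).
Local Notation A := (dom Om).
Local Notation K := (closure (dom Om)).
Implicit Types f : R * R -> R.

Lemma bm_closure (D : set (R * R)) f : measurable (D : set (mR * mR)) -> D `<=` K ->
  {within K, continuous f} -> bm (D : set (mR * mR)) f.
Proof.
move=> mD DK cf; have [B fB] := compact_fun_bounded (@dom_compact_closure _ Om) cf; split.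
  apply: (@measurable_funS _ _ _ _ K) => //.
    by apply: closed_measurable_plane; exact: closed_closure.
  by apply: continuous_measurable_plane => //; apply: closed_measurable_plane; exact: closed_closure.
by exists B => x /DK /fB.
Qed.

Section BoundaryIntegral.
Implicit Types phi psi : R * R -> R.

Definition bd_bm phi := forall i, bm (T := mR) `[0, 1]%classic (fun t => phi (@bcurve R Om i t)).

Let m01 : measurable (`[0, 1]%classic : set mR).
Proof. exact: measurable_itv. Qed.

Let bms phi i : bd_bm phi ->
  bm (T := mR) `[0, 1]%classic (fun t => phi (@bcurve R Om i t) * speed (bcurve i) t).
Proof. by move=> bphi; apply: bmM; [exact: bphi|exact: bm_speed]. Qed.

Lemma bd_bm_continuous f : {within K, continuous f} -> bd_bm f.
Proof. by move=> cf i; exact: bm_bcurve. Qed.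

Lemma int_bdD phi psi : bd_bm phi -> bd_bm psi ->
  int_bd Om (fun x => phi x + psi x) = int_bd Om phi + int_bd Om psi.
Proof.
move=> bphi bpsi; rewrite /int_bd -big_split/=; apply: eq_bigr => i _.
rewrite -(RintegralD_bm m01 (unit_itv_fin R)); try exact: bms.
by apply: eq_Rintegral => t _; rewrite mulrDl.
Qed.

Lemma int_bdZ c phi : bd_bm phi -> int_bd Om (fun x => c * phi x) = c * int_bd Om phi.
Proof.
move=> bphi; rewrite /int_bd mulr_sumr; apply: eq_bigr => i _.
rewrite -(RintegralZ_bm m01 (unit_itv_fin R)); last exact: bms.
by apply: eq_Rintegral => t _; rewrite mulrA.
Qed.

Lemma int_bd_ge0 phi : (forall x, 0 <= phi x) -> 0 <= int_bd Om phi.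
Proof.
move=> phi0; apply: sumr_ge0 => i _; apply: Rintegral_ge0 => t _.
by rewrite mulr_ge0// /speed sqrtr_ge0.
Qed.

End BoundaryIntegral.

Variable U : set (R * R).
Hypotheses (oU : open U) (UA : U `<=` A) (AU0 : leb2 (A `\` U) = 0%E).

Let mU : measurable (U : set (mR * mR)).
Proof. exact: open_measurable_plane. Qed.

Let mA : measurable (A : set (mR * mR)).
Proof. by apply: open_measurable_plane; exact: dom_open. Qed.

Let fU : (leb2 U < +oo)%E.
Proof.
apply: le_lt_trans (leb2_dom_fin Om); apply: le_measure; rewrite ?inE//.
Qed.

Lemma int_dom_regular f : int_dom Om f = \int[leb2]_(x in U) f x.
Proof.
rewrite /int_dom (Rintegral_setD_null _ _ (measurableD mA mU) AU0); congr Rintegral.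
apply/seteqP; split=> x; last by move=> Ux; split; [exact: UA|case].
by move=> [Ax nAU]; apply: contrapT => nU; exact: nAU.
Qed.

Section Regular.
Variable f : R * R -> R.
Hypotheses (fV : Vh Th f) (fU' : forall x, U x -> affine_near f x).

Let cf : {within K, continuous f} := fV.1.

Lemma bm_Vh : bm (U : set (mR * mR)) f.
Proof. by apply: bm_closure => //; apply: subset_trans UA _; exact: subset_closure. Qed.

Lemma Vh_lipschitz_line : exists2 L, 0 <= L &
  (forall x h, 0 <= h -> (forall r, 0 <= r <= h -> A (x.1 + r, x.2)) ->
    `|f (x.1 + h, x.2) - f x| <= L * h) /\
  (forall x h, 0 <= h -> (forall r, 0 <= r <= h -> A (x.1, x.2 + r)) ->
    `|f (x.1, x.2 + h) - f x| <= L * h).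
Proof.
have [L L0 fL] := Vh_lipschitz fV; exists L => //.
have k (c r : R) : {for r, continuous (fun r : R => c + r)}.
  by apply: continuousD; [exact: cst_continuous|exact: cvg_id].
have dist (c r r' : R) : c + r - (c + r') = r - r' by ring.
split=> x h h0 Ax.
  have := fL (fun r => (x.1 + r, x.2)) h h0; rewrite addr0 -surjective_pairing; apply.
  - by move=> r; exact: (cvg_pair (k x.1 r) (@cst_continuous _ _ x.2 r)).
  - by move=> r r' /=; rewrite dist subrr normr0.
  - by move=> r rh; apply: subset_closure; exact: Ax.
have := fL (fun r => (x.1, x.2 + r)) h h0; rewrite addr0 -surjective_pairing; apply.
- by move=> r; exact: (cvg_pair (@cst_continuous _ _ x.1 r) (k x.2 r)).
- by move=> r r' /=; rewrite dist subrr normr0.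
- by move=> r rh; apply: subset_closure; exact: Ax.
Qed.

(** The partial derivatives are locally constant on the open set [U], hence measurable, and the
    slope of an affine piece is at most the Lipschitz constant along lines. *)
Lemma bm_pd : bm (U : set (mR * mR)) (pd1 f) /\ bm (U : set (mR * mR)) (pd2 f).
Proof.
have m (pd : R * R -> R) : (forall x, U x -> \forall y \near x, pd y = pd x) ->
    measurable_fun (U : set (mR * mR)) (pd : mR * mR -> R).
  move=> pdE; apply: continuous_measurable_plane => //.
  apply/subspace_continuousP => x Ux; apply: cvg_within_filter.
  suff : pd y @[y --> x] --> pd x by [].
  by apply: cvg_near_cst; exact: pdE.
have [L L0 [lip1 lip2]] := Vh_lipschitz_line.
have nA x : U x -> \forall y \near x, A y.
  by move=> Ux; apply: open_nbhs_nbhs; split; [exact: dom_open|exact: UA].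
have small (P : set R) : (\forall h \near (0 : R), P h) ->
    exists2 h, 0 < h & forall r, 0 <= r <= h -> P r.
  move=> /nbhs_ballP[e /= e0 eP]; exists (e / 2); first by rewrite divr_gt0.
  move=> r /andP[r0 re]; apply: eP; rewrite /ball/= sub0r normrN ger0_norm//; lra.
have bound (c v h : R) : 0 < h -> `|v + c * h - v| <= L * h -> `|c| <= L.
  by move=> h0; rewrite addrAC subrr add0r normrM (gtr0_norm h0) ler_pM2r.
split; split.
- apply: m => x Ux; have := affine_near_near (fU' Ux) => E.
  by near=> y; have [] // : [/\ affine_near f y, pd1 f y = pd1 f x & pd2 f y = pd2 f x] by near: y.
- exists L => x Ux; have [E _] := affine_nearP (fU' Ux).
  have [h1 h10 H1] := small _ E; have [h2 h20 H2] := small _ (near_hline (nA x Ux)).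
  pose h := Num.min h1 h2; have h0 : 0 < h by rewrite lt_min h10.
  apply: (bound _ (f x) h h0); rewrite -H1 ?ge_min ?lexx ?(ltW h0)//.
  apply: lip1; first exact: ltW.
  by move=> r /andP[r0 rh]; apply: H2; rewrite r0 (le_trans rh)// ge_min lexx orbT.
- apply: m => x Ux; have := affine_near_near (fU' Ux) => E.
  by near=> y; have [] // : [/\ affine_near f y, pd1 f y = pd1 f x & pd2 f y = pd2 f x] by near: y.
- exists L => x Ux; have [_ E] := affine_nearP (fU' Ux).
  have [h1 h10 H1] := small _ E; have [h2 h20 H2] := small _ (near_vline (nA x Ux)).
  pose h := Num.min h1 h2; have h0 : 0 < h by rewrite lt_min h10.
  apply: (bound _ (f x) h h0); rewrite -H1 ?ge_min ?lexx ?(ltW h0)//.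
  apply: lip2; first exact: ltW.
  by move=> r /andP[r0 rh]; apply: H2; rewrite r0 (le_trans rh)// ge_min lexx orbT.
Unshelve. all: by end_near. Qed.

(** The power [f^(m+1)] inherits a Lipschitz bound along segments because [f] is bounded on the
    closure. The cases [m = 1] and [m = 2] serve the drift and the convection. *)
Lemma Vh_trace (m : nat) :
  `|\int[leb2]_(x in U) (m.+1%:R * f x ^+ m * pd1 f x)| <=
    2 * int_bd Om (fun x => `|f x ^+ m.+1|) /\
  `|\int[leb2]_(x in U) (m.+1%:R * f x ^+ m * pd2 f x)| <=
    2 * int_bd Om (fun x => `|f x ^+ m.+1|).
Proof.
have [B fB] := compact_fun_bounded (@dom_compact_closure _ Om) cf.
have [L L0 [lip1 lip2]] := Vh_lipschitz_line.
have cfm : {within K, continuous (fun x => f x ^+ m.+1)}.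
  move=> x; apply: (@continuous_comp (subspace K) R R f (fun y => y ^+ m.+1)); first exact: cf.
  exact: exprn_continuous.
have KA := @subset_closure _ A.
have lipm (x y : R * R) h : 0 <= h -> A x -> A y -> `|f y - f x| <= L * h ->
    `|f y ^+ m.+1 - f x ^+ m.+1| <= m.+1%:R * B ^+ m * L * h.
  move=> h0 Ax Ay fyx; have By := fB _ (KA _ Ay); have Bx := fB _ (KA _ Ax).
  rewrite (le_trans (expr_lipschitz m By Bx))// -[leRHS]mulrA ler_wpM2l//.
  by rewrite mulr_ge0// exprn_ge0// (le_trans _ Bx).
have [b1 b2] := bm_pd.
split.
- apply: (@trace_dom1 R Om (fun x => f x ^+ m.+1) _ (m.+1%:R * B ^+ m * L)) => //.
    move=> x h h0 Ax; apply: lipm => //; last exact: lip1.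
      by have := Ax 0; rewrite addr0 -surjective_pairing; apply; rewrite lexx.
    by apply: Ax; rewrite h0 lexx.
  move=> x Ux; have [E _] := affine_nearP (fU' Ux).
  by have := @exp_quotient_near_affine _ _ _ _ m E; rewrite /= addr0 -surjective_pairing.
- apply: (@trace_dom2 R Om (fun x => f x ^+ m.+1) _ (m.+1%:R * B ^+ m * L)) => //.
  + have [] // := bmM (bmZ m.+1%:R (bmX m bm_Vh)) b2.
  + move=> x h h0 Ax; apply: lipm => //; last exact: lip2.
      by have := Ax 0; rewrite addr0 -surjective_pairing; apply; rewrite lexx.
    by apply: Ax; rewrite h0 lexx.
  + move=> x Ux; have [_ E] := affine_nearP (fU' Ux).
    by have := @exp_quotient_near_affine _ _ _ _ m E; rewrite /= addr0 -surjective_pairing.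
Qed.

Lemma energy_estimate (nu c2 wd : R) : 0 <= nu -> 0 < c2 -> 0 <= wd ->
  0 <= nu * ip_grad Om f f + wd * ip Om (grad_dot1 f) f
       + ip Om (fun x => f x * grad_dot1 f x) f
       + int_bd Om (fun x => (2 * (c2 + wd) * f x + 2 / (9 * c2) * f x ^+ 3) * f x).
Proof.
move=> nu0 c20 wd0; have [b1 b2] := bm_pd; have bf := bm_Vh.
have g0 : 0 <= ip_grad Om f f.
  by apply: Rintegral_ge0 => x _; rewrite -!expr2 addr_ge0// sqr_ge0.
have [t11 t12] := Vh_trace 1; have [t21 t22] := Vh_trace 2.
have E m : bm (U : set (mR * mR)) (fun x => m.+1%:R * f x ^+ m * pd1 f x) /\
           bm (U : set (mR * mR)) (fun x => m.+1%:R * f x ^+ m * pd2 f x).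
  by split; apply: bmM => //; apply: bmZ; exact: bmX.
have I1 : 2 * ip Om (grad_dot1 f) f = \int[leb2]_(x in U) (2%:R * f x ^+ 1 * pd1 f x) +
    \int[leb2]_(x in U) (2%:R * f x ^+ 1 * pd2 f x).
  have [e1 e2] := E 1%N; rewrite /ip int_dom_regular -(RintegralD_bm mU fU e1 e2).
  rewrite -(RintegralZ_bm mU fU); last by apply: bmM => //; exact: bmD.
  by apply: eq_Rintegral => x _; rewrite /grad_dot1; ring.
have I2 : 3 * ip Om (fun x => f x * grad_dot1 f x) f =
    \int[leb2]_(x in U) (3%:R * f x ^+ 2 * pd1 f x) +
    \int[leb2]_(x in U) (3%:R * f x ^+ 2 * pd2 f x).
  have [e1 e2] := E 2%N; rewrite /ip int_dom_regular -(RintegralD_bm mU fU e1 e2).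
  rewrite -(RintegralZ_bm mU fU); last by do 2 apply: bmM => //; exact: bmD.
  by apply: eq_Rintegral => x _; rewrite /grad_dot1; ring.
have bdf := bd_bm_continuous cf.
have bdX n : bd_bm (fun x => `|f x ^+ n|).
  by move=> i; apply: bm_norm; apply: bmX; exact: bdf.
set Q2 := int_bd Om (fun x => `|f x ^+ 2|) in t11 t12.
set Q3 := int_bd Om (fun x => `|f x ^+ 3|) in t21 t22.
(* Completing the square: [2 c2 f^2 + 2/(9 c2) f^4] is [4/3 |f|^3] plus the last integrand. *)
have bd_split : int_bd Om (fun x => (2 * (c2 + wd) * f x + 2 / (9 * c2) * f x ^+ 3) * f x) =
   2 * wd * Q2 + (4 / 3 * Q3 + int_bd Om (fun x => 2 / (9 * c2) * (f x ^+ 2 * (3 * c2 - `|f x|) ^+ 2))).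
  have bdr : bd_bm (fun x => 2 / (9 * c2) * (f x ^+ 2 * (3 * c2 - `|f x|) ^+ 2)).
    move=> i; apply: bmZ; apply: bmM; first by apply: bmX; exact: bdf.
    apply: bmX; apply: bmD; first exact: bm_cst.
    apply: (@eq_bm _ _ _ _ (fun t => -1 * `|f (bcurve i t)|)); first by move=> t _; rewrite mulN1r.
    by apply: bmZ; apply: bm_norm; exact: bdf.
  have bA : bd_bm (fun x => 2 * wd * `|f x ^+ 2|) by move=> i; apply: bmZ; exact: bdX.
  have bB : bd_bm (fun x => 4 / 3 * `|f x ^+ 3|) by move=> i; apply: bmZ; exact: bdX.
  have bBr : bd_bm (fun x => 4 / 3 * `|f x ^+ 3| +
      2 / (9 * c2) * (f x ^+ 2 * (3 * c2 - `|f x|) ^+ 2)) by move=> i; apply: bmD; [exact: bB|exact: bdr].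
  rewrite -(int_bdZ _ (bdX 2%N)) -(int_bdZ _ (bdX 3%N)) -(int_bdD bB bdr) -(int_bdD bA bBr).
  congr int_bd; apply/funext => x.
  have n2 : `|f x ^+ 2| = f x ^+ 2 by rewrite ger0_norm ?sqr_ge0.
  have n3 : `|f x ^+ 3| = f x ^+ 2 * `|f x| by rewrite exprSr normrM n2.
  have n4 : `|f x| ^+ 2 = f x ^+ 2 by rewrite real_normK ?num_real.
  rewrite n2 n3; have -> : (3 * c2 - `|f x|) ^+ 2 = 9 * c2 ^+ 2 - 6 * c2 * `|f x| + f x ^+ 2.
    by rewrite -n4; ring.
  by field; rewrite gt_eqF.
have r0 : 0 <= int_bd Om (fun x => 2 / (9 * c2) * (f x ^+ 2 * (3 * c2 - `|f x|) ^+ 2)).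
  apply: int_bd_ge0 => x; rewrite mulr_ge0//; first by rewrite divr_ge0// mulr_ge0// ltW.
  by rewrite mulr_ge0// sqr_ge0.
rewrite bd_split.
exact: (energy_arith I1 I2 t11 t12 t21 t22 wd0 (mulr_ge0 nu0 g0) r0).
Qed.

End Regular.

End Energy.

(** * An orthonormal basis of the finite element space *)

Section OrthonormalBasis.
Variables (R : realType) (Om : smooth_domain R) (Th : triangulation Om).
Local Notation leb := (@lebesgue_measure R).
Local Notation leb2 := (leb \x leb)%E.
Local Notation mR := (measurableTypeR R).
Local Notation A := (dom Om).
Local Notation K := (closure (dom Om)).
Implicit Types f g : R * R -> R.

Let mA : measurable (A : set (mR * mR)).
Proof. by apply: open_measurable_plane; exact: dom_open. Qed.

Let fA : (leb2 A < +oo)%E := leb2_dom_fin Om.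

Lemma bm_dom f : {within K, continuous f} -> bm (A : set (mR * mR)) f.
Proof. by apply: bm_closure => //; exact: subset_closure. Qed.

Lemma continuous_within_lin (I : Type) (s : seq I) (w : I -> R) (F : I -> R * R -> R) :
  (forall i, {within K, continuous (F i)}) ->
  {within K, continuous (fun x => \sum_(i <- s) w i * F i x)}.
Proof.
move=> cF; apply: (@continuous_sum R (subspace K) R) => i x.
exact: (continuousM (@cst_continuous _ _ (w i) x) (cF i x)).
Qed.

Lemma Vh_lin (I : Type) (s : seq I) (w : I -> R) (F : I -> R * R -> R) :
  (forall i, Vh Th (F i)) -> Vh Th (fun x => \sum_(i <- s) w i * F i x).
Proof.
move=> FV; split; first by apply: continuous_within_lin => i; exact: (FV i).1.
move=> k; elim: s => [|i s [a [b [c E]]]].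
  by exists 0, 0, 0 => x _; rewrite big_nil; ring.
have [a' [b' [c' E']]] := (FV i).2 k.
exists (w i * a' + a), (w i * b' + b), (w i * c' + c) => x kx.
by rewrite big_cons E// E'//; ring.
Qed.

Lemma Vh_lin2 (a b : R) f g : Vh Th f -> Vh Th g -> Vh Th (fun x => a * f x + b * g x).
Proof.
move=> fV gV; have := @Vh_lin bool [:: true; false] (fun i => if i then a else b)
  (fun i => if i then f else g) (fun i => if i as i return Vh Th (if i then f else g) then fV else gV).
by under eq_fun do rewrite !big_cons big_nil addr0.
Qed.

Lemma ipC f g : ip Om f g = ip Om g f.
Proof. by apply: eq_Rintegral => x _; rewrite mulrC. Qed.

Lemma ip_suml (I : Type) (s : seq I) (w : I -> R) (F : I -> R * R -> R) g :
  (forall i, {within K, continuous (F i)}) -> {within K, continuous g} ->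
  ip Om (fun x => \sum_(i <- s) w i * F i x) g = \sum_(i <- s) w i * ip Om (F i) g.
Proof.
move=> cF cg; have b i : bm (A : set (mR * mR)) (fun x => F i x * g x).
  by apply: bmM; exact: bm_dom.
transitivity (\int[leb2]_(x in A) \sum_(i <- s) w i * (F i x * g x)).
  by apply: eq_Rintegral => x _; rewrite mulr_suml; apply: eq_bigr => i _; rewrite mulrA.
rewrite (Rintegral_sum_bm mA fA); last by move=> i; exact: bmZ.
by apply: eq_bigr => i _; rewrite (RintegralZ_bm mA fA).
Qed.

Lemma ip_ge0 f : 0 <= ip Om f f.
Proof. by apply: Rintegral_ge0 => x _; rewrite -expr2 sqr_ge0. Qed.

(** A nonzero value in the open set persists, up to a factor 2, on a small square of positive area;
    boundary points follow by density and continuity. *)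
Lemma ip_eq0 f : {within K, continuous f} -> ip Om f f = 0 -> forall x, K x -> f x = 0.
Proof.
move=> cf ff0.
have f0 x : A x -> f x = 0.
  move=> Ax; apply/eqP/negPn/negP => fx0.
  have fx2 : 0 < `|f x| / 2 by rewrite divr_gt0// normr_gt0.
  have cfx := Vh_continuous_at cf Ax.
  have : \forall y \near x, `|f x - f y| < `|f x| / 2 by apply: (cvgr_dist_lt _ _ cfx).
  have : \forall y \near x, A y by apply: open_nbhs_nbhs; split=> //; exact: dom_open.
  move=> /nbhs_ballP[e1 /= e10 E1] /nbhs_ballP[e2 /= e20 E2].
  pose e := Num.min e1 e2 / 2; have e0 : 0 < e by rewrite divr_gt0// lt_min e10.
  have ee : e < Num.min e1 e2 by rewrite /e; have := e0; rewrite /e; lra.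
  have /andP[ee1 ee2] : (e < e1) && (e < e2) by rewrite -lt_min.
  pose B : set (mR * mR) := `[x.1 - e, x.1 + e]%classic `*` `[x.2 - e, x.2 + e]%classic.
  have mB : measurable B by apply: measurableX; exact: measurable_itv.
  have Bball r y : e < r -> B y -> ball x r y.
    move=> er [/=]; rewrite !in_itv/= => /andP[a1 a2] /andP[b1 b2].
    by split; rewrite /ball/= ltr_norml; apply/andP; split; lra.
  have BA : B `<=` A by move=> y By; apply: E1; exact: Bball.
  pose c := (`|f x| / 2) ^+ 2; have c0 : 0 < c by rewrite exprn_gt0.
  have : \int[leb2]_(y in A) (c * \1_B y) <= ip Om f f.
    have bf := bm_dom cf.
    apply: (le_Rintegral_bm mA fA); [by apply: bmZ; exact: bm_indic|exact: bmM|].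
    move=> y Ay; rewrite indicE; case: (boolP (y \in B)) => [|_] /=; last by rewrite mulr0 -expr2 sqr_ge0.
    rewrite inE mulr1 -expr2 /c => By; rewrite -[f y ^+ 2]real_normK ?num_real//.
    have /E2 fxy := Bball _ _ ee2 By.
    apply: lerXn2r; rewrite ?nnegrE ?(ltW fx2)//.
    have := lerB_dist (f x) (f x - f y); rewrite opprB addrCA subrr addr0.
    by move: fxy => /=; lra.
  rewrite ff0 (RintegralZ_bm mA fA); last exact: bm_indic.
  rewrite (Rintegral_indic _ mA mB) setIidl//.
  suff -> : fine (leb2 B) = 4 * e ^+ 2 by rewrite leNgt mulr_gt0// mulr_gt0// exprn_gt0.
  by rewrite /B leb2_box/=; [ring|lra|lra].
move=> x Kx; apply/eqP/negPn/negP => fx0.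
move/subspace_continuousP : cf => /(_ x Kx) /cvgr_neq0 /(_ fx0) nz.
have N : \forall y \near x, K y -> f y != 0 by exact: nz.
have [y [Ay Ny]] := Kx _ N.
by have /eqP := Ny (subset_closure Ay); apply; exact: f0.
Qed.

Definition Vh_orthonormal d (e : 'I_d -> R * R -> R) :=
  (forall i, Vh Th (e i)) /\ forall i j, ip Om (e i) (e j) = (i == j)%:R.

Lemma orthonormal_coord d (e : 'I_d -> R * R -> R) (w : 'I_d -> R) j : Vh_orthonormal e ->
  ip Om (fun x => \sum_i w i * e i x) (e j) = w j.
Proof.
move=> [eV e1]; rewrite ip_suml; [|by move=> i; exact: (eV i).1|exact: (eV j).1].
rewrite (bigD1 j)//= e1 eqxx mulr1 big1 ?addr0// => i ij.
by rewrite e1 (negbTE ij) mulr0.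
Qed.

Lemma eq_ip f1 f2 g : (forall x, K x -> f1 x = f2 x) -> ip Om f1 g = ip Om f2 g.
Proof.
move=> E; apply: eq_Rintegral => x; rewrite inE => Ax.
by rewrite E//; exact: subset_closure.
Qed.

(** With more functions than affine coefficients, some nontrivial combination has all its
    coefficients zero on every element. It vanishes on the closure, and pairing it with each [e j]
    shows that its weights are zero. *)
Lemma orthonormal_bound d (e : 'I_d -> R * R -> R) : Vh_orthonormal e -> (d <= ntri Th * 3)%N.
Proof.
move=> eo; have [eV _] := eo; rewrite leqNgt; apply/negP => dn.
have /choice[co coE] := fun i => Vh_coef (eV i).
pose M i : 'M[R]_(ntri Th, 3) := \matrix_(j, k) (if k == 0 then (co i j).1.1 else
  if k == 1 then (co i j).1.2 else (co i j).2).
pose C : 'M[R]_(d, ntri Th * 3) := \matrix_(i, l) mxvec (M i) 0 l.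
have : kermx C != 0.
  rewrite kermx_eq0 /row_free; apply: contraTneq dn => <-.
  by rewrite -leqNgt rank_leq_col.
move=> /rowV0Pn[v /sub_kermxP vC v0].
have vM j k : \sum_i v 0 i * M i j k = 0.
  have := congr1 (fun B : 'rV_(ntri Th * 3) => B 0 (mxvec_index j k)) vC.
  rewrite !mxE => E; rewrite -[RHS]E; apply: eq_bigr => i _.
  by rewrite [in RHS]mxE mxvecE.
have vE x : K x -> \sum_i v 0 i * e i x = 0.
  move=> Kx; have [j _ jx] : (\bigcup_i @elt R Om Th i) x by rewrite (elt_cover Th).
  rewrite (eq_bigr (fun i => v 0 i * M i j 0 + v 0 i * M i j 1 * x.1 + v 0 i * M i j 2%:R * x.2)).
    by rewrite !big_split/= -!mulr_suml !vM !mul0r !addr0.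
  by move=> i _; rewrite (coE _ _ _ jx) !mxE/=; ring.
case/eqP: v0; apply/rowP => j; rewrite mxE -(orthonormal_coord (v 0) j eo).
rewrite (@eq_ip _ (fun x => 0)); first by rewrite /ip /int_dom; under eq_Rintegral do rewrite mul0r;
  rewrite Rintegral_cst// mul0r.
by move=> x /vE.
Qed.

(** An orthonormal family of maximal size spans: otherwise the normalised remainder of some [chi]
    would extend it. The expansion holds on the closure, where the inner product determines a
    function. *)
Theorem orthonormal_basis : exists d, exists e : 'I_d -> R * R -> R, Vh_orthonormal e /\
  forall chi, Vh Th chi -> forall x, K x -> chi x = \sum_i ip Om chi (e i) * e i x.
Proof.
pose P d := `[< exists e : 'I_d -> R * R -> R, Vh_orthonormal e >].
have P0 : exists d, P d.
  exists 0%N; apply/asboolP; exists (fun _ _ => 0).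
  by split=> -[].
have Pb d : P d -> (d <= ntri Th * 3)%N by move=> /asboolP[e]; exact: orthonormal_bound.
have [d /asboolP[e eo] dmax] := ex_maxnP P0 Pb.
exists d, e; split=> // chi chiV; have [eV e1] := eo.
pose w i := ip Om chi (e i).
pose r x := 1 * chi x + -1 * \sum_i w i * e i x.
have sV : Vh Th (fun x => \sum_i w i * e i x) by exact: Vh_lin.
have rV : Vh Th r by exact: Vh_lin2.
have re j : ip Om r (e j) = 0.
  have := @ip_suml bool [:: true; false] (fun i => if i then 1 else -1)
    (fun i => if i then chi else (fun x => \sum_i w i * e i x)) (e j).
  have -> : (fun x => \sum_(i <- [:: true; false]) (if i then 1 else -1) *
     (if i then chi else (fun x => \sum_i w i * e i x)) x) = r.
    by apply/funext => x; rewrite !big_cons big_nil addr0.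
  move=> ->; last 2 first.
  - by case; [exact: chiV.1|exact: sV.1].
  - exact: (eV j).1.
  by rewrite !big_cons big_nil orthonormal_coord// /w; ring.
have [rr0|rr0] := eqVneq (ip Om r r) 0.
  by move=> x Kx; have /eqP := ip_eq0 rV.1 rr0 Kx; rewrite /r mul1r mulN1r subr_eq0 => /eqP.
have rr : 0 < ip Om r r by rewrite lt_neqAle eq_sym rr0 ip_ge0.
pose q := (Num.sqrt (ip Om r r))^-1.
(* The zero term only gives the shape expected by [Vh_lin2]. *)
pose r' x := q * r x + 0 * r x.
have r'V : Vh Th r' by exact: Vh_lin2.
have r'E g : {within K, continuous g} -> ip Om r' g = q * ip Om r g.
  move=> cg; rewrite /ip /int_dom -(RintegralZ_bm mA fA); last first.
    by apply: bmM; apply: bm_dom => //; exact: rV.1.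
  by apply: eq_Rintegral => x _; rewrite /r'; ring.
have r'e j : ip Om r' (e j) = 0 by rewrite r'E ?re ?mulr0//; exact: (eV j).1.
have r'r' : ip Om r' r' = 1.
  rewrite r'E; last exact: r'V.1.
  rewrite ipC r'E; last exact: rV.1.
  rewrite mulrA -expr2 exprVn sqr_sqrtr ?ip_ge0// mulVf//.
pose e' (i : 'I_d.+1) := if unlift ord_max i is Some j then e j else r'.
have : P d.+1.
  apply/asboolP; exists e'; split=> [i|i j]; rewrite /e'.
    by case: unliftP.
  case: unliftP => [i' ->|->]; case: unliftP => [j' ->|->].
  - by rewrite e1 (inj_eq (lift_inj)).
  - by rewrite ipC r'e eq_sym (negbTE (neq_lift _ _)).
  - by rewrite r'e (negbTE (neq_lift _ _)).
  - by rewrite eqxx.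
by move=> /dmax; rewrite ltnn.
Qed.

End OrthonormalBasis.

(** * The Galerkin system *)

Section Separable.
Variables (R : realType) (d : nat) (dX : measure_display) (X : measurableType dX).
Variables (mu : {measure set X -> \bar R}) (D : set X).
Hypotheses (mD : measurable D) (fD : (mu D < +oo)%E).

(** A class stable under sums and products; integrating in [x] leaves a finite sum of continuous
    functions of [w], which gives continuity of the Galerkin system at once. *)
Definition separable (G : 'rV[R]_d -> X -> R) :=
  exists (I : finType) (p : I -> 'rV[R]_d -> R) (f : I -> X -> R),
    [/\ forall i, continuous (p i), forall i, bm D (f i) &
      forall w x, D x -> G w x = \sum_i p i w * f i x].

Lemma separable_bm f : bm D f -> separable (fun _ => f).
Proof.
move=> bf; exists unit, (fun _ _ => 1), (fun _ => f); split=> //.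
- by move=> _ w; exact: cst_continuous.
- by move=> w x _; rewrite big_const card_unit /= addr0 mul1r.
Qed.

Lemma separable_coord i : separable (fun w _ => w 0 i).
Proof.
exists unit, (fun _ w => w 0 i), (fun _ _ => 1); split=> //.
- by move=> _ w; exact: coord_continuous.
- by move=> _; exact: bm_cst.
- by move=> w x _; rewrite big_const card_unit /= addr0 mulr1.
Qed.

Lemma separableD G1 G2 : separable G1 -> separable G2 ->
  separable (fun w x => G1 w x + G2 w x).
Proof.
move=> [I1 [p1 [f1 [c1 b1 E1]]]] [I2 [p2 [f2 [c2 b2 E2]]]].
exists (I1 + I2)%type, (fun i => match i with inl j => p1 j | inr j => p2 j end),
  (fun i => match i with inl j => f1 j | inr j => f2 j end); split.
- by case.
- by case.
- by move=> w x Dx; rewrite E1// E2// big_sumType.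
Qed.

Lemma separableM G1 G2 : separable G1 -> separable G2 ->
  separable (fun w x => G1 w x * G2 w x).
Proof.
move=> [I1 [p1 [f1 [c1 b1 E1]]]] [I2 [p2 [f2 [c2 b2 E2]]]].
exists (I1 * I2)%type, (fun i w => p1 i.1 w * p2 i.2 w), (fun i x => f1 i.1 x * f2 i.2 x).
split.
- by move=> i w; exact: (continuousM (c1 i.1 w) (c2 i.2 w)).
- by move=> i; exact: bmM.
- move=> w x Dx; rewrite E1// E2// mulr_suml.
  rewrite (eq_bigr (fun i => \sum_j p1 i w * p2 j w * (f1 i x * f2 j x))).
    by rewrite pair_bigA.
  by move=> i _; rewrite mulr_sumr; apply: eq_bigr => j _; ring.
Qed.

Lemma separable_sum (J : Type) (s : seq J) (G : J -> 'rV[R]_d -> X -> R) :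
  (forall j, separable (G j)) -> separable (fun w x => \sum_(j <- s) G j w x).
Proof.
move=> sG; elim: s => [|j s IH].
  under eq_fun do under eq_fun do rewrite big_nil.
  by apply: separable_bm; exact: bm_cst.
under eq_fun do under eq_fun do rewrite big_cons.
exact: separableD.
Qed.

Lemma continuous_separable_int G : separable G ->
  continuous (fun w => \int[mu]_(x in D) G w x).
Proof.
move=> [I [p [f [cp bf E]]]].
have -> : (fun w => \int[mu]_(x in D) G w x) =
    fun w => \sum_i p i w * \int[mu]_(x in D) f i x.
  apply/funext => w.
  have -> : \int[mu]_(x in D) G w x = \int[mu]_(x in D) \sum_i p i w * f i x.
    by apply: eq_Rintegral => x; rewrite inE => /E.
  rewrite (Rintegral_sum_bm mD fD); last by move=> i; exact: bmZ.
  by apply: eq_bigr => i _; rewrite (RintegralZ_bm mD fD).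
apply: (@continuous_sum R _ R) => i w.
exact: (continuousM (cp i w) (@cst_continuous _ _ _ w)).
Qed.

End Separable.

Lemma separable_bm_at (R : realType) (d : nat) (dX : measure_display) (X : measurableType dX)
    (D : set X) (G : 'rV[R]_d -> X -> R) w : separable D G -> bm D (G w).
Proof.
move=> [I [p [f [_ bf E]]]]; apply: (@eq_bm _ _ _ _ (fun x => \sum_i p i w * f i x)).
  by move=> x Dx; rewrite E.
by apply: bm_sum => i; exact: bmZ.
Qed.

Lemma continuous_row (R : realType) (n : nat) (T : topologicalType) (f : 'I_n -> T -> R) :
  (forall j, continuous (f j)) -> continuous (fun x => \row_j f j x : 'rV[R]_n).
Proof.
move=> cf; have -> : (fun x => \row_j f j x) =
    (fun x => \sum_j f j x *: (delta_mx 0 j : 'rV[R]_n)).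
  apply/funext => x; rewrite [LHS]row_sum_delta; apply: eq_bigr => j _; by rewrite mxE.
apply: continuous_sum => j x; apply: continuousZ; first exact: cf.
exact: cst_continuous.
Qed.

Section Galerkin.
Variables (R : realType) (Om : smooth_domain R) (Th : triangulation Om).
Variables (nu c2 wd theta k : R).
Hypotheses (nu_gt0 : 0 < nu) (c2_gt0 : 0 < c2) (wd_ge0 : 0 <= wd).
Hypotheses (theta_gt0 : 0 < theta) (k_gt0 : 0 < k).
Variables (d : nat) (e : 'I_d -> R * R -> R).
Hypothesis eo : Vh_orthonormal Th e.
Local Notation leb := (@lebesgue_measure R).
Local Notation leb2 := (leb \x leb)%E.
Local Notation mR := (measurableTypeR R).
Local Notation A := (dom Om).
Local Notation K := (closure (dom Om)).
Variables (Wn : R * R -> R) (n0 : 'rV[R]_d).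
Implicit Types (w c : 'rV[R]_d).

(** [comb1] and [comb2] are linear in [w] at every point and equal the partial derivatives of
    [comb w] on [U]. *)
Definition comb w (x : R * R) : R := \sum_i w 0 i * e i x.
Definition comb1 w (x : R * R) : R := \sum_i w 0 i * pd1 (e i) x.
Definition comb2 w (x : R * R) : R := \sum_i w 0 i * pd2 (e i) x.

Hypothesis WnE : forall x, K x -> Wn x = comb n0 x.

Let eV i : Vh Th (e i) := eo.1 i.
Let U := regular_set Om e.
Let oU : open U := @regular_set_open R Om _ e.
Let UA : U `<=` A. Proof. by move=> x []. Qed.
Let AU0 : leb2 (A `\` U) = 0%E := regular_set_null eV.
Let AK : A `<=` K := @subset_closure _ A.
Let mU : measurable (U : set (mR * mR)). Proof. exact: open_measurable_plane. Qed.
Let mA : measurable (A : set (mR * mR)).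
Proof. by apply: open_measurable_plane; exact: dom_open. Qed.
Let fU : (leb2 U < +oo)%E.
Proof. by apply: le_lt_trans (leb2_dom_fin Om); apply: le_measure; rewrite ?inE. Qed.
Let m01 : measurable (`[0, 1]%classic : set mR). Proof. exact: measurable_itv. Qed.
Let f01 := unit_itv_fin R.

Lemma comb_Vh w : Vh Th (comb w).
Proof. exact: Vh_lin. Qed.

Lemma comb_regular w x : U x -> [/\ affine_near (comb w) x,
  pd1 (comb w) x = comb1 w x & pd2 (comb w) x = comb2 w x].
Proof. by move=> [_ ex]; exact: affine_near_lin. Qed.

(** Equality on the closure gives equality near each point of [U], hence equal derivatives there. *)
Lemma eq_pd_closure f w x : (forall y, K y -> f y = comb w y) -> U x ->
  pd1 f x = comb1 w x /\ pd2 f x = comb2 w x.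
Proof.
move=> fE Ux; have [[a [b [c E]]] <- <-] := comb_regular w Ux.
have [-> ->] := affine_near_pd E; apply: (@affine_near_pd _ _ _ a).
have nA : \forall y \near x, A y.
  by apply: open_nbhs_nbhs; split; [exact: dom_open|exact: UA].
near=> y; rewrite fE; first by near: y.
by apply: AK; near: y.
Unshelve. all: by end_near. Qed.

Definition boundary_flux (y : R) : R := 2 * (c2 + wd) * y + 2 / (9 * c2) * y ^+ 3.
(** With [w] the coordinates of [W^(n+theta)], this is [(W^(n+1) - W^n) / k] tested with [e j]. *)
Definition time_term j w x : R := (comb w x - Wn x) / (theta * k) * e j x.
Definition diffusion_term j w x : R := comb1 w x * pd1 (e j) x + comb2 w x * pd2 (e j) x.
Definition drift_term j w x : R := (comb1 w x + comb2 w x) * e j x.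
Definition convection_term j w x : R := comb w x * (comb1 w x + comb2 w x) * e j x.
Definition boundary_term i j w t : R :=
  boundary_flux (comb w (@bcurve R Om i t)) * e j (bcurve i t) * speed (bcurve i) t.

Let bme j : bm (U : set (mR * mR)) (e j).
Proof. by apply: bm_Vh (eV j). Qed.

Let bmpd j : bm (U : set (mR * mR)) (pd1 (e j)) /\ bm (U : set (mR * mR)) (pd2 (e j)).
Proof. by apply: bm_pd (eV j) _ => // x [_]; apply. Qed.

Let sep_lin (f : 'I_d -> R * R -> R) : (forall j, bm (U : set (mR * mR)) (f j)) ->
  separable (U : set (mR * mR)) (fun w x => \sum_i w 0 i * f i x).
Proof.
move=> bf; apply: separable_sum => i; apply: separableM; first exact: separable_coord.
exact: separable_bm.
Qed.

Let sep_comb : separable (U : set (mR * mR)) comb. Proof. exact: sep_lin. Qed.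
Let sep_comb1 : separable (U : set (mR * mR)) comb1.
Proof. by apply: sep_lin => j; have [] := bmpd j. Qed.
Let sep_comb2 : separable (U : set (mR * mR)) comb2.
Proof. by apply: sep_lin => j; have [] := bmpd j. Qed.

Let sep0 j : separable (U : set (mR * mR)) (time_term j).
Proof.
have bWn : bm (U : set (mR * mR)) (fun x => - Wn x).
  apply: (@eq_bm _ _ _ _ (fun x => -1 * comb n0 x)).
    by move=> x Ux; rewrite mulN1r WnE//; exact/AK/UA.
  by apply: bmZ; exact: (separable_bm_at n0 sep_comb).
apply: separableM; last exact: separable_bm.
apply: separableM; last by apply: separable_bm; exact: bm_cst.
by apply: separableD => //; exact: separable_bm.
Qed.

Let sep1 j : separable (U : set (mR * mR)) (diffusion_term j).
Proof.
have [b1 b2] := bmpd j.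
by apply: separableD; apply: separableM => //; exact: separable_bm.
Qed.

Let sep2 j : separable (U : set (mR * mR)) (drift_term j).
Proof. by apply: separableM; [exact: separableD|exact: separable_bm]. Qed.

Let sep3 j : separable (U : set (mR * mR)) (convection_term j).
Proof.
apply: separableM; last exact: separable_bm.
by apply: separableM => //; exact: separableD.
Qed.

Let bmb i j : bm (T := mR) `[0, 1]%classic (fun t => e j (@bcurve R Om i t)).
Proof. by apply: bm_bcurve; exact: (eV j).1. Qed.

Let sep4 i j : separable (X := mR) (`[0, 1]%classic : set mR) (boundary_term i j).
Proof.
have sc : separable (`[0, 1]%classic : set mR) (fun w t => comb w (@bcurve R Om i t)).
  apply: separable_sum => l; apply: separableM; first exact: separable_coord.
  exact: separable_bm.
have sk (r : R) : separable (`[0, 1]%classic : set mR) (fun w _ => r : R).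
  by apply: separable_bm; exact: bm_cst.
apply: separableM; last by apply: separable_bm; exact: bm_speed.
apply: separableM; last exact: separable_bm.
apply: separableD; first exact: separableM.
by apply: separableM => //; do 2 apply: separableM => //.
Qed.

Definition residual w : 'rV[R]_d := \row_j
  (\int[leb2]_(x in U) time_term j w x + nu * \int[leb2]_(x in U) diffusion_term j w x +
   wd * \int[leb2]_(x in U) drift_term j w x + \int[leb2]_(x in U) convection_term j w x +
   \sum_i \int[leb]_(t in `[0, 1]) boundary_term i j w t).

Lemma residual_continuous : continuous residual.
Proof.
apply: continuous_row => j w.
have k_ (r : R) : {for w, continuous (fun _ : 'rV[R]_d => r)} by exact: cst_continuous.
have i0 := @continuous_separable_int _ _ _ _ leb2 _ mU fU _ (sep0 j) w.
have i1 := @continuous_separable_int _ _ _ _ leb2 _ mU fU _ (sep1 j) w.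
have i2 := @continuous_separable_int _ _ _ _ leb2 _ mU fU _ (sep2 j) w.
have i3 := @continuous_separable_int _ _ _ _ leb2 _ mU fU _ (sep3 j) w.
have i4 : {for w, continuous (fun w => \sum_i \int[leb]_(t in `[0, 1]) boundary_term i j w t)}.
  by apply: (@continuous_sum R _ R) => i; exact: (@continuous_separable_int _ _ _ _ leb _ m01 f01 _ (sep4 i j)).
exact: (continuousD (continuousD (continuousD (continuousD i0 (continuousM (k_ nu) i1))
  (continuousM (k_ wd) i2)) i3) i4).
Qed.

Lemma int_dom_expand (F : R * R -> R) (g : 'I_d -> R * R -> R) c :
  (forall x, U x -> F x = \sum_j c 0 j * g j x) ->
  (forall j, bm (U : set (mR * mR)) (g j)) ->
  int_dom Om F = \sum_j c 0 j * \int[leb2]_(x in U) g j x.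
Proof.
move=> FE bg; rewrite (int_dom_regular oU UA AU0).
have -> : \int[leb2]_(x in U) F x = \int[leb2]_(x in U) \sum_j c 0 j * g j x.
  by apply: eq_Rintegral => x; rewrite inE => /FE.
rewrite (Rintegral_sum_bm mU fU); last by move=> j; exact: bmZ.
by apply: eq_bigr => j _; rewrite (RintegralZ_bm mU fU).
Qed.

(** The scheme is linear in [chi], so testing it amounts to pairing the residual with coordinates.
    It is used with [chi = W] for coercivity and with arbitrary [chi] at the end. *)
Lemma weak_form (Z W chi : R * R -> R) w c :
  (forall x, K x -> Z x = (comb w x - Wn x) / (theta * k)) ->
  (forall x, K x -> W x = comb w x) -> (forall x, K x -> chi x = comb c x) ->
  ip Om Z chi + nu * ip_grad Om W chi + wd * ip Om (grad_dot1 W) chi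
  + ip Om (fun x => W x * grad_dot1 W x) chi
  + int_bd Om (fun x => (2 * (c2 + wd) * W x + 2 / (9 * c2) * W x ^+ 3) * chi x) =
  \sum_j residual w 0 j * c 0 j.
Proof.
move=> ZE WE chiE; have UK x : U x -> K x by move=> /UA /AK.
have E0 : ip Om Z chi = \sum_j c 0 j * \int[leb2]_(x in U) time_term j w x.
  apply: int_dom_expand => [x Ux|j]; last exact: separable_bm_at.
  rewrite ZE ?chiE; try exact: UK.
  by rewrite mulr_sumr; apply: eq_bigr => j _; rewrite /time_term; ring.
have E1 : ip_grad Om W chi = \sum_j c 0 j * \int[leb2]_(x in U) diffusion_term j w x.
  apply: int_dom_expand => [x Ux|j]; last exact: separable_bm_at.
  have [-> ->] := eq_pd_closure WE Ux; have [-> ->] := eq_pd_closure chiE Ux.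
  by rewrite !mulr_sumr -big_split/=; apply: eq_bigr => j _; rewrite /diffusion_term; ring.
have E2 : ip Om (grad_dot1 W) chi = \sum_j c 0 j * \int[leb2]_(x in U) drift_term j w x.
  apply: int_dom_expand => [x Ux|j]; last exact: separable_bm_at.
  rewrite /grad_dot1; have [-> ->] := eq_pd_closure WE Ux; rewrite chiE; last exact: UK.
  by rewrite mulr_sumr; apply: eq_bigr => j _; rewrite /drift_term; ring.
have E3 : ip Om (fun x => W x * grad_dot1 W x) chi =
    \sum_j c 0 j * \int[leb2]_(x in U) convection_term j w x.
  apply: int_dom_expand => [x Ux|j]; last exact: separable_bm_at.
  rewrite /grad_dot1; have [-> ->] := eq_pd_closure WE Ux; rewrite chiE ?WE; try exact: UK.
  by rewrite mulr_sumr; apply: eq_bigr => j _; rewrite /convection_term; ring.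
have E4 : int_bd Om (fun x => (2 * (c2 + wd) * W x + 2 / (9 * c2) * W x ^+ 3) * chi x) =
    \sum_j c 0 j * \sum_i \int[leb]_(t in `[0, 1]) boundary_term i j w t.
  under [RHS]eq_bigr do rewrite mulr_sumr.
  rewrite exchange_big/=; apply: eq_bigr => i _.
  have -> : \sum_j c 0 j * \int[leb]_(t in `[0, 1]) boundary_term i j w t =
      \int[leb]_(t in `[0, 1]) \sum_j c 0 j * boundary_term i j w t.
    rewrite (Rintegral_sum_bm m01 f01); last by move=> j; apply: bmZ; exact: separable_bm_at.
    by apply: eq_bigr => j _; rewrite (RintegralZ_bm m01 f01)//; exact: separable_bm_at.
  apply: eq_Rintegral => t _; have [Kt _] := bcurve_in i t.
  rewrite WE// chiE// mulr_sumr mulr_suml; apply: eq_bigr => j _.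
  by rewrite /boundary_term /boundary_flux; ring.
rewrite E0 E1 E2 E3 E4 !mulr_sumr -!big_split/=; apply: eq_bigr => j _.
by rewrite mxE; ring.
Qed.

(** The time term contributes [|w|^2 - (n0, w)], up to a positive factor, which is at least
    [(|w|^2 - |n0|^2) / 2]; the other terms are nonnegative by [energy_estimate]. *)
Lemma residual_coercive w : sqn n0 <= sqn w -> 0 <= \sum_j residual w 0 j * w 0 j.
Proof.
move=> nw; have tk0 : 0 < theta * k by rewrite mulr_gt0.
rewrite -(@weak_form (fun x => (comb w x - Wn x) / (theta * k)) (comb w) (comb w) w w)//.
have en := @energy_estimate R Om Th U oU UA AU0 (comb w) (comb_Vh w)
   (fun x Ux => let: And3 a _ _ := comb_regular w Ux in a) nu c2 wd (ltW nu_gt0) c2_gt0 wd_ge0.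
have ip0 : ip Om (fun x => (comb w x - Wn x) / (theta * k)) (comb w) =
    (theta * k)^-1 * (sqn w - \sum_j n0 0 j * w 0 j).
  rewrite ipC.
  rewrite (@ip_suml _ _ _ _ (fun i => w 0 i) e); last 2 first.
  - by move=> i; exact: (eV i).1.
  - have cW : {within K, continuous (comb w)} := (comb_Vh w).1.
    have cn : {within K, continuous (comb n0)} := (comb_Vh n0).1.
    have : {within K, continuous (fun x => (comb w x - comb n0 x) * (theta * k)^-1)}.
      move=> x; exact: (continuousM (continuousB (cW x) (cn x)) (@cst_continuous _ _ _ x)).
    apply: subspace_eq_continuous => x; rewrite inE => Kx.
    by rewrite /from_subspace /= WnE.
  rewrite mulrBr /sqn !mulr_sumr -sumrB; apply: eq_bigr => j _.
  rewrite ipC (@eq_ip _ _ _ (fun x => \sum_i ((theta * k)^-1 * (w 0 i - n0 0 i)) * e i x)).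
    by rewrite (orthonormal_coord _ _ eo); ring.
  move=> x Kx; rewrite WnE// /comb -sumrB mulr_suml; apply: eq_bigr => i _; ring.
have : 0 <= ip Om (fun x => (comb w x - Wn x) / (theta * k)) (comb w).
  rewrite ip0 mulr_ge0 ?invr_ge0 ?(ltW tk0)//.
  have : 0 <= \sum_j (w 0 j - n0 0 j) ^+ 2 by apply: sumr_ge0 => j _; rewrite sqr_ge0.
  have -> : \sum_j (w 0 j - n0 0 j) ^+ 2 = sqn w - 2 * \sum_j n0 0 j * w 0 j + sqn n0.
    rewrite /sqn mulr_sumr -sumrB -big_split/=; apply: eq_bigr => j _; ring.
  by lra.
move=> i0; have := addr_ge0 i0 en; rewrite !addrA; apply.
Qed.

End Galerkin.

Theorem lemma4p3 (R : realType) (Om : smooth_domain R) (Th : triangulation Om)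
    (nu c2 wd theta k : R)
    (nu_gt0 : 0 < nu) (c2_gt0 : 0 < c2) (wd_ge0 : 0 <= wd)
    (theta_ge : 1 / 2 <= theta) (theta_le : theta <= 1) (k_gt0 : 0 < k)
    (Wn : R * R -> R) (WnV : Vh Th Wn) :
  exists Wn1 : R * R -> R, Vh Th Wn1 /\
    let W := fun x => theta * Wn1 x + (1 - theta) * Wn x in
    forall chi : R * R -> R, Vh Th chi ->
      ip Om (fun x => (Wn1 x - Wn x) / k) chi
      + nu * ip_grad Om W chi
      + wd * ip Om (grad_dot1 W) chi
      + ip Om (fun x => W x * grad_dot1 W x) chi
      + int_bd Om (fun x => (2 * (c2 + wd) * W x + 2 / (9 * c2) * W x ^+ 3) * chi x)
      = 0.
Proof.
have theta0 : 0 < theta by lra.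
have [d [e [eo eb]]] := orthonormal_basis Th.
pose n0 : 'rV[R]_d := \row_i ip Om Wn (e i).
have combE chi : Vh Th chi -> forall x, closure Om x ->
    chi x = comb e (\row_i ip Om chi (e i)) x.
  by move=> chiV x Kx; rewrite eb//; apply: eq_bigr => i _; rewrite mxE.
have WnE := combE _ WnV.
pose res := residual Om nu c2 wd theta k e Wn.
have [w res0] : exists w, res w = 0.
  have s0 : 0 <= sqn n0 by apply: sumr_ge0 => i _; rewrite sqr_ge0.
  (* The radius must be at least the norm of [n0]; adding 1 keeps it positive when [n0 = 0]. *)
  have r0 : 0 < Num.sqrt (sqn n0) + 1 by rewrite ltr_wpDl ?sqrtr_ge0.
  apply: (coercive_zero r0); first exact: (residual_continuous eo WnE).
  move=> w wr; apply: (residual_coercive nu_gt0 c2_gt0 wd_ge0 theta0 k_gt0 eo WnE).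
  rewrite wr -[leLHS](sqr_sqrtr s0).
  by apply: lerXn2r; rewrite ?nnegrE ?addr_ge0 ?sqrtr_ge0 ?lerDl.
(* Solve [W = theta * Wn1 + (1 - theta) * Wn] for [Wn1], with [W = comb e w]. *)
pose Wn1 x := theta^-1 * comb e w x + - ((1 - theta) / theta) * Wn x.
exists Wn1; split; first by apply: Vh_lin2 => //; exact: comb_Vh.
move=> W chi chiV.
have WE x : closure Om x -> W x = comb e w x.
  by move=> _; rewrite /W /Wn1; field; rewrite gt_eqF.
rewrite (weak_form nu c2 wd (theta := theta) (k := k) eo WnE (w := w) _ WE (combE _ chiV)).
  by apply: big1 => j _; rewrite -/res -/(res w) res0 [X in X * _]mxE mul0r.
by move=> x _; rewrite /Wn1; field; rewrite !gt_eqF.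
Qed.
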